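(* Let $H\in(0,1/2)$, $T>0$, and let $\{B^H_t\}_{t\in[0,T]}$ be a fractional Brownian motion with Hurst index $H$, i.e. a continuous centered Gaussian process with $E(B^H_tB^H_s)=\frac12\left(t^{2H}+s^{2H}-|t-s|^{2H}\right)$, considered with its natural filtration $\mathcal F_t=\sigma\{B^H_u:0\le u\le t\}$. Then for every sequence $\{\theta_n\}$ of normally condensing partitions of $[0,T]$, \[\sup_n E\big(A^{\theta_n}_T\big)^2=+\infty,\] where $A^{\theta_n}_T=\sum_{k=1}^{k^{\theta_n}}E\big(B^H_{t_k^{\theta_n}}-B^H_{t_{k-1}^{\theta_n}}\,\big|\,\mathcal F_{t_{k-1}^{\theta_n}}\big)$ is the terminal value of the predictable compensator of the discretization of $B^H$ on $\theta_n$. (In this sense $B^H$ admits no local predictor.)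
   Context: A sequence $\{\theta_n\}$ of partitions $0=t_0^{\theta_n}<t_1^{\theta_n}<\dots<t^{\theta_n}_{k^{\theta_n}}=T$ of $[0,T]$ is normally condensing if $\theta_n\subset\theta_{n+1}$ and the mesh $|\theta_n|=\max_k(t_k^{\theta_n}-t_{k-1}^{\theta_n})\to0$ as $n\to\infty$. *)

(* Defs.v *)
From HB Require Import structures.
From mathcomp Require Import all_boot all_order all_algebra.
From mathcomp Require Import all_classical all_reals all_analysis.
Set Implicit Arguments. Unset Strict Implicit. Unset Printing Implicit Defensive.
Import Order.TTheory GRing.Theory Num.Theory.
Import numFieldNormedType.Exports.
Local Open Scope classical_set_scope.
Local Open Scope ring_scope.

Definition fbm_cov {R : realType} (H t s : R) : R :=
  (t `^ (2 * H) + s `^ (2 * H) - `|t - s| `^ (2 * H)) / 2.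

Definition centered_gaussian {d} {Omega : measurableType d} {R : realType}
  (P : probability Omega R) (X : Omega -> R) (v : R) : Prop :=
  forall A : set R, measurable A ->
    P (X @^-1` A) = if v == 0 then \d_(0:R) A else normal_prob 0 (Num.sqrt v) A.

(** B is a continuous centered Gaussian process on [0,T] with the fBm
    covariance: every finite linear combination of the B t, t in [0,T],
    is centered Gaussian with the variance dictated by the covariance. *)
Definition is_fBm {d} {Omega : measurableType d} {R : realType}
  (P : probability Omega R) (H T : R) (B : R -> Omega -> R) : Prop :=
  [/\ (forall t, measurable_fun setT (B t)),
      (forall w, {within `[0, T], continuous (fun t => B t w)}) &
      (forall (n : nat) (ts cs : 'I_n -> R),
        (forall i, 0 <= ts i <= T) ->
        centered_gaussian P (fun w => \sum_(i < n) cs i * B (ts i) w)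
          (\sum_(i < n) \sum_(j < n) cs i * cs j * fbm_cov H (ts i) (ts j)))].

Definition natural_filtration {d} {Omega : measurableType d} {R : realType}
  (B : R -> Omega -> R) (t : R) : set (set Omega) :=
  <<s \bigcup_(u in `[0, t]) preimage_set_system setT (B u) measurable >>.

Definition is_cond_exp {d} {Omega : measurableType d} {R : realType}
  (P : probability Omega R) (G : set (set Omega)) (X Y : Omega -> R) : Prop :=
  [/\ (forall A : set R, measurable A -> G (Y @^-1` A)),
      P.-integrable setT (fun w => (Y w)%:E) &
      (forall A, G A -> (\int[P]_(w in A) (Y w)%:E = \int[P]_(w in A) (X w)%:E)%E)].

Definition is_partition {R : realType} (T : R) (s : seq R) : Prop :=
  [/\ sorted <%R s, s != [::], head 0 s = 0 & last 0 s = T].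

Definition mesh {R : realType} (s : seq R) : R :=
  \big[Num.max/0]_(i < (size s).-1) (s`_i.+1 - s`_i).

Definition normally_condensing {R : realType} (T : R) (theta : nat -> seq R) : Prop :=
  [/\ (forall n, is_partition T (theta n)),
      (forall n, {subset theta n <= theta n.+1}) &
      (mesh (theta n) @[n --> \oo] --> (0 : R))].

(* Main.v *)
Require Import Defs.
From HB Require Import structures.
From mathcomp Require Import all_boot all_order all_algebra.
From mathcomp Require Import all_classical all_reals all_analysis.
From mathcomp Require Import measurable_realfun ring lra.
Import Order.TTheory GRing.Theory Num.Theory.
Import numFieldNormedType.Exports.
Local Open Scope classical_set_scope.
Local Open Scope ring_scope.

(** Write the increment of B over the k-th cell of the partition as D_k + Y_k, with Y_k its
    conditional expectation.  The D_k are orthogonal martingale increments, so the second moment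
    of B_T - B_0 - A is the sum of the E D_k^2, and it suffices to prove the local
    nondeterminism bound E (B_(s+h) - B_s - Z)^2 >= h^(2H) / 2 (up to the second moment m2 of
    the standard normal law) for every square integrable Z measurable with respect to F_s: then
    the sum is at least of order T mesh^(2H-1), which tends to infinity as 2H < 1.

    For Z a linear combination of the B_u, u <= s, the bound is elementary.  On the finitely many
    distances involved the concave function x^(2H) is a combination with nonnegative coefficients
    of the functions min(x, l), and l - min(|u - v|, l) is the length of the overlap of the windows
    [u, u + l[ and [v, v + l[; the window at s + h has a part of length min(h, l) which no
    window at a point u <= s meets.

    For Z a trigonometric polynomial in the B_u, u <= s, project B_(s+h) - B_s on the finitely many
    linear combinations of the B_u occurring in Z.  The residual x is uncorrelated with each of
    these, v say, so c x + v and - c x + v have the same law, whence x is orthogonal to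
    sin(v + a) and the nonlinear Z does no better than the linear projection.  Finally, the
    trigonometric polynomials form an algebra of bounded functions whose L2 closure contains
    all bounded functions measurable with respect to F_s. *)

Set Implicit Arguments.
Unset Strict Implicit.
Unset Printing Implicit Defensive.

(** * Integration of real-valued functions *)

Section real_integrable.
Context d (T : measurableType d) (R : realType).
Variable mu : {measure set T -> \bar R}.
Implicit Types f g : T -> R.

Definition Rintegrable f := mu.-integrable setT (EFin \o f).

Lemma RintegrableD f g : Rintegrable f -> Rintegrable g ->
  Rintegrable (fun x => f x + g x).
Proof. by move=> fi gi; have := integrableD measurableT fi gi. Qed.

Lemma RintegrableB f g : Rintegrable f -> Rintegrable g ->
  Rintegrable (fun x => f x - g x).
Proof. by move=> fi gi; have := integrableB measurableT fi gi. Qed.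

Lemma RintegrableZ k f : Rintegrable f -> Rintegrable (fun x => k * f x).
Proof. by move=> fi; have := integrableZl measurableT k fi. Qed.

Lemma Rintegrable_sum I (s : seq I) (f : I -> T -> R) :
  (forall i, Rintegrable (f i)) -> Rintegrable (fun x => \sum_(i <- s) f i x).
Proof.
move=> fi; have := @integrable_sum _ _ _ mu setT measurableT _ s predT
  (fun i => EFin \o f i) (fun i _ => fi i).
by apply: eq_integrable => // x _ /=; rewrite sumEFin.
Qed.

Lemma Rintegrable_measurable f : Rintegrable f -> measurable_fun setT f.
Proof. by move/integrableP => [/measurable_EFinP]. Qed.

Lemma le_Rintegrable f g : measurable_fun setT f ->
  (forall x, `|f x| <= g x) -> Rintegrable g -> Rintegrable f.
Proof.
move=> mf fg; apply: le_integrable => //; first exact/measurable_EFinP.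
by move=> x _ /=; rewrite lee_fin (le_trans (fg x))// ler_norm.
Qed.

Lemma Rintegral_sum I (s : seq I) (f : I -> T -> R) :
  (forall i, Rintegrable (f i)) ->
  \int[mu]_x (\sum_(i <- s) f i x) = \sum_(i <- s) \int[mu]_x (f i x).
Proof.
move=> fi; elim: s => [|i s IH].
  by rewrite big_nil; under eq_Rintegral do rewrite big_nil; rewrite Rintegral_cst ?mul0r.
rewrite big_cons -IH; under eq_Rintegral do rewrite big_cons.
by rewrite RintegralD//; [exact: fi|exact: Rintegrable_sum].
Qed.

Lemma Rintegral_cvg (f_ : nat -> T -> R) f g :
  (forall n, measurable_fun setT (f_ n)) -> measurable_fun setT f ->
  (forall x, f_ n x @[n --> \oo] --> f x) ->
  Rintegrable g -> (forall n x, `|f_ n x| <= g x) ->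
  \int[mu]_x f_ n x @[n --> \oo] --> \int[mu]_x f x.
Proof.
move=> mf_ mf ff_ ig fg.
have [|||||fi _ +] := @dominated_convergence _ T R mu setT measurableT
   (fun n => EFin \o f_ n) (EFin \o f) (EFin \o g).
- by move=> n; exact/measurable_EFinP.
- exact/measurable_EFinP.
- by apply: aeW => x _; apply: cvg_EFin; [exact: nearW|exact: ff_].
- exact: ig.
- by apply: aeW => x n _; rewrite /= lee_fin.
rewrite -[X in _ --> X]fineK; last exact: integrable_fin_num.
by move/fine_cvgP => [_].
Qed.

End real_integrable.

(** * Quadratic forms of kernels and overlaps of windows *)

Section kernel.
Context {R : realType}.
Notation mu := (@lebesgue_measure R).
Implicit Types x y : seq (R * R).

(** A list of pairs encodes a finite signed measure, mass first and point second; this is the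
    bilinear form of the kernel [k] on such measures. *)
Definition quad (k : R -> R -> R) x y : R :=
  \sum_(p <- x) \sum_(q <- y) p.1 * q.1 * k p.2 q.2.

Lemma window_overlap (u v l : R) : 0 <= l ->
  \int[mu]_z (\1_(`[u, u + l[) z * \1_(`[v, v + l[) z) =
  l - Num.min `|u - v| l.
Proof.
move=> l0; wlog uv : u v / u <= v => [H|].
  have [|/ltW] := leP u v; first exact: H.
  by move/H; rewrite distrC => <-; apply: eq_Rintegral => z _; rewrite mulrC.
transitivity (\int[mu]_z \1_(`[v, u + l[) z).
  apply: eq_Rintegral => z _; rewrite !indicE -natrM mulnb !mem_setE !in_itv/=.
  by congr (_ %:R); congr nat_of_bool; apply/idP/idP; lra.
rewrite /Rintegral integral_indic//= setIT lebesgue_measure_itv/= lte_fin.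
rewrite ler0_norm ?subr_le0// /Num.min.
by case: ifPn => /=; case: ifPn => /=; lra.
Qed.

Let Rintegrable_window (u l : R) : Rintegrable mu (\1_(`[u, u + l[)).
Proof. exact: integrable_indic_itv. Qed.

Let Rintegrable_windowM (u v l : R) :
  Rintegrable mu (fun z => \1_(`[u, u + l[) z * \1_(`[v, v + l[) z).
Proof.
apply: (le_Rintegrable _ _ (Rintegrable_window u l)).
  by apply: measurable_funM; exact: measurable_indic.
by move=> z; rewrite !indicE; case: (_ \in _); case: (_ \in _); rewrite !(mulr0,mulr1,normr0,normr1).
Qed.

Lemma quad_cstB (k : R -> R -> R) l x :
  quad (fun u v => l - k u v) x x = l * (\sum_(p <- x) p.1) ^+ 2 - quad k x x.
Proof.
rewrite /quad expr2 big_distrlr/= mulr_sumr -sumrB; apply: eq_bigr => p _.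
rewrite mulr_sumr -sumrB; apply: eq_bigr => q _; ring.
Qed.

(** The total mass of the list is 0, so the constant in the overlap length [l - min] drops out and
    the negated form is the integral of [g ^+ 2], with [g] the weighted superposition of the
    windows. Where only the window at [s + h] is open, [g] equals 1. *)
Lemma quad_min_ge (l s h : R) x : 0 <= l -> 0 <= h ->
  all (fun p => p.2 <= s) x -> \sum_(p <- x) p.1 = -1 ->
  Num.min h l <= - quad (fun u v => Num.min `|u - v| l) ((1, s + h) :: x) ((1, s + h) :: x).
Proof.
move=> l0 h0 xs x1; set y := _ :: x.
have y0 : \sum_(p <- y) p.1 = 0 by rewrite big_cons x1/=; lra.
pose g z := \sum_(p <- y) p.1 * \1_(`[p.2, p.2 + l[) z.
have gE z : g z ^+ 2 = \sum_(p <- y) \sum_(q <- y)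
    p.1 * q.1 * (\1_(`[p.2, p.2 + l[) z * \1_(`[q.2, q.2 + l[) z).
  rewrite expr2 big_distrlr/=; apply: eq_bigr => p _; apply: eq_bigr => q _; ring.
have ig : Rintegrable mu (fun z => g z ^+ 2).
  rewrite (funext gE); apply: Rintegrable_sum => p.
  by apply: Rintegrable_sum => q; exact: RintegrableZ.
have <- : \int[mu]_z (g z ^+ 2) =
    - quad (fun u v => Num.min `|u - v| l) y y.
  rewrite -[RHS]add0r -[X in X + _](_ : l * (\sum_(p <- y) p.1) ^+ 2 = 0); last first.
    by rewrite y0 expr0n mulr0.
  rewrite -quad_cstB; under eq_Rintegral do rewrite gE.
  rewrite Rintegral_sum; last first.
    by move=> p; apply: Rintegrable_sum => q; exact: RintegrableZ.
  apply: eq_bigr => p _; rewrite Rintegral_sum; last by move=> q; exact: RintegrableZ.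
  apply: eq_bigr => q _; rewrite RintegralZl//; last exact: Rintegrable_windowM.
  by rewrite window_overlap.
(* Every window starting at or before [s] has ended by [s + l], so only the window at [s + h] is
   open on [[c, s + h + l[], whose length is [min h l]. *)
pose c : R := Num.max (s + h) (s + l).
have -> : Num.min h l = \int[mu]_z \1_(`[c, s + h + l[) z.
  rewrite /Rintegral integral_indic//= setIT lebesgue_measure_itv/= lte_fin /c.
  by rewrite /Num.max /Num.min; do 2 case: ifPn => /=; case: ifPn => /=; lra.
apply: le_Rintegral => //; first exact: integrable_indic_itv.
move=> z _; rewrite indicE mem_setE in_itv/=; have [|_] := boolP (_ && _); last exact: sqr_ge0.
rewrite ge_max => /andP[/andP[z1 z2] z3].
rewrite /g big_cons/= indicE mem_setE in_itv/= z1 z3 big_seq big1.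
  by rewrite addr0 mulr1 expr1n.
move=> p px; rewrite indicE mem_setE in_itv/=.
move/allP : xs => /(_ _ px) ps; case: (boolP (_ && _)); rewrite ?mulr0//; lra.
Qed.

End kernel.

(** * Concave functions of the distance *)

Section concave.
Context {R : realType}.
Implicit Types x y : seq (R * R).

(** Induction on the points in decreasing order. By concavity the chord over the two largest points
    [e < d] has the least slope [k], so [f u - k * u] is still nondecreasing and concave on the
    remaining points; the linear part comes back as [k * min u d]. *)
Lemma concave_min_decomposition (f : R -> R) (D : seq R) :
  sorted >%R D -> 0 \in D -> (forall u, u \in D -> 0 <= u) -> f 0 = 0 ->
  (forall u v, u \in D -> v \in D -> u <= v -> f u <= f v) ->
  (forall u v w, u \in D -> v \in D -> w \in D -> u < v -> v < w ->
    (f w - f v) * (v - u) <= (f v - f u) * (w - v)) ->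
  exists c : seq (R * R),
    (forall p, p \in c -> 0 <= p.1 /\ 0 <= p.2 <= head 0 D) /\
    (forall u, u \in D -> f u = \sum_(p <- c) p.1 * Num.min u p.2).
Proof.
elim: D f => [//|d [|e D] IH] f.
  move=> _ + _ f0 _ _; rewrite inE => /eqP <-; exists [::]; split => // u.
  by rewrite inE => /eqP ->; rewrite f0 big_nil.
move=> sD; move: (sD) => /= /andP[ed pD] D0 Dge0 f0 mono conc.
have eD u : u \in e :: D -> u <= e.
  rewrite inE => /predU1P[-> //|uD].
  have /allP/(_ _ uD) := order_path_min (rev_trans lt_trans) pD.
  exact: ltW.
have sub u : u \in e :: D -> u \in d :: e :: D by rewrite !inE => ->; rewrite orbT.
have e0 : 0 <= e by apply: Dge0; rewrite !inE eqxx orbT.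
have eIn : e \in [:: d, e & D] by rewrite !inE eqxx orbT.
have dIn : d \in [:: d, e & D] by rewrite !inE eqxx.
pose k := (f d - f e) / (d - e).
have de0 : 0 < d - e by lra.
have kE : k * (d - e) = f d - f e by rewrite /k divfK// gt_eqF.
have k0 : 0 <= k.
  apply: divr_ge0; last exact: ltW.
  by rewrite subr_ge0; apply: mono => //; exact: ltW.
have [c [c0 cE]] : exists c : seq (R * R),
    (forall p, p \in c -> 0 <= p.1 /\ 0 <= p.2 <= head 0 (e :: D)) /\
    (forall u, u \in e :: D -> f u - k * u = \sum_(p <- c) p.1 * Num.min u p.2).
  apply: (IH (fun u => f u - k * u)) => //=.
  - by move: D0; rewrite inE => /predU1P[d0|//]; move: ed e0; lra.
  - by move=> u uD; apply/Dge0/sub.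
  - by rewrite f0 mulr0 subr0.
  - move=> u v uD vD; rewrite le_eqVlt => /predU1P[->//|uv].
    have kvd : k * (d - v) <= f d - f v.
      have := eD _ vD; rewrite le_eqVlt => /predU1P[->|ve]; first by rewrite kE.
      have := conc _ _ _ (sub _ vD) eIn dIn ve ed; rewrite -kE => H.
      have : k * (e - v) <= f e - f v.
        rewrite -(ler_pM2r de0); apply: le_trans H; lra.
      by move: kE; lra.
    have vd : v < d by apply: le_lt_trans ed; exact: eD.
    have := conc _ _ _ (sub _ uD) (sub _ vD) dIn uv vd => H.
    have dv0 : 0 < d - v by lra.
    suff : k * (v - u) <= f v - f u by lra.
    rewrite -(ler_pM2r dv0); apply: le_trans H.
    rewrite mulrAC ler_wpM2r//; lra.
  - move=> u v w uD vD wD uv vw.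
    have := conc _ _ _ (sub _ uD) (sub _ vD) (sub _ wD) uv vw; lra.
exists ((k, d) :: c); split.
  move=> p; rewrite inE => /predU1P[->/=|/c0/= [-> /andP[-> pe]]].
    by split => //; rewrite lexx (le_trans e0)// ltW.
  by rewrite (le_trans pe (ltW ed)).
(* At [d] the older terms keep their values at [e], since their thresholds are at most [e]; at the
   other points [min u d] is [u]. *)
move=> u; rewrite inE => /predU1P[->|uD]; rewrite big_cons/=.
  have -> : f d = k * d + (f e - k * e) by move: kE; lra.
  rewrite minxx cE ?inE ?eqxx//; congr (_ + _).
  apply: eq_big_seq => p /c0/= [_ /andP[_ pe]]; rewrite !min_r//.
  by rewrite (le_trans pe (ltW ed)).
by rewrite -cE// min_l; [lra|rewrite (le_trans (eD _ uD) (ltW ed))].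
Qed.

(** This is Young's inequality for the [a]-th power of [w] and the number 1, with conjugate
    exponents [1 / a] and [1 / (1 - a)]. *)
Lemma powR_le_tangent (a w : R) : 0 < a < 1 -> 0 <= w -> w `^ a <= a * w + (1 - a).
Proof.
move=> /andP[a0 a1] w0.
have a'0 : 0 < 1 - a by lra.
have := @conjugate_powR R (w `^ a) 1 a^-1 (1 - a)^-1 (powR_ge0 _ _) ler01.
rewrite !invr_gt0 !invrK => /(_ a0 a'0); rewrite -powRrM divff ?gt_eqF// powRr1//.
by rewrite mulr1 powR1 mul1r addrC subrK => /(_ erefl); rewrite mulrC.
Qed.

(** Both chord slopes are compared with the slope [k] of the tangent at [v], obtained from the
    tangent at 1 by scaling. *)
Lemma powR_slope (a u v w : R) : 0 < a < 1 -> 0 <= u -> u < v -> v < w ->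
  (w `^ a - v `^ a) * (v - u) <= (v `^ a - u `^ a) * (w - v).
Proof.
move=> a01 u0 uv vw; have v0 : 0 < v by lra.
have tan z : 0 <= z -> z `^ a <= v `^ a + v `^ a * (a / v) * (z - v).
  move=> z0; have zv0 : 0 <= z / v by rewrite divr_ge0// ltW.
  have -> : z `^ a = v `^ a * (z / v) `^ a.
    by rewrite -powRM ?(ltW v0)// mulrC divfK// gt_eqF.
  rewrite -[leRHS](_ : v `^ a * (a * (z / v) + (1 - a)) = _).
    by rewrite ler_wpM2l ?powR_ge0// powR_le_tangent.
  by field; rewrite gt_eqF.
have := tan u u0; have := tan w; set k := _ * (a / v) => /(_ _) tw tu.
have {}tw : w `^ a <= v `^ a + k * (w - v) by apply: tw; lra.
have A1 : (w `^ a - v `^ a) * (v - u) <= k * (w - v) * (v - u).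
  by rewrite ler_pM2r; lra.
have A2 : k * (v - u) * (w - v) <= (v `^ a - u `^ a) * (w - v).
  by rewrite ler_pM2r; lra.
lra.
Qed.

Lemma quad_powR_ge (a s h : R) x : 0 < a < 1 -> 0 <= h ->
  all (fun p => p.2 <= s) x -> \sum_(p <- x) p.1 = -1 ->
  h `^ a <= - quad (fun u v => `|u - v| `^ a) ((1, s + h) :: x) ((1, s + h) :: x).
Proof.
move=> a01 h0 xs x1; set y := _ :: x.
(* Including [h] makes the left side expand with the same weights as the form, so that [quad_min_ge]
   can be applied threshold by threshold. *)
pose D0 := undup (0 :: h :: [seq `|p.2 - q.2| | p <- y, q <- y]).
pose D := rev (sort <=%R D0).
have DE : D =i 0 :: h :: [seq `|p.2 - q.2| | p <- y, q <- y].
  by move=> z; rewrite mem_rev mem_sort mem_undup.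
have Dge0 u : u \in D -> 0 <= u.
  rewrite DE !(in_cons 0, in_cons h) => /predU1P[->//|/predU1P[->//|/allpairsP[p [_ _ ->]]]].
  exact: normr_ge0.
have [||||||c [c0 cE]] := @concave_min_decomposition (fun u => u `^ a) D.
- by rewrite /D rev_sorted sort_lt_sorted undup_uniq.
- by rewrite DE in_cons eqxx.
- exact: Dge0.
- by rewrite powR0//; case/andP : a01 => ? _; rewrite gt_eqF.
- move=> u v /Dge0 u0 /Dge0 v0 uv; apply: ge0_ler_powR => //.
  by case/andP: a01 => /ltW.
- by move=> u v w /Dge0 u0 _ _; exact: powR_slope.
rewrite cE; last by rewrite DE (in_cons 0) (in_cons h) eqxx orbT.
have -> : quad (fun u v => `|u - v| `^ a) y y =
    \sum_(l <- c) l.1 * quad (fun u v => Num.min `|u - v| l.2) y y.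
  transitivity (\sum_(p <- y) \sum_(q <- y) \sum_(l <- c)
      l.1 * (p.1 * q.1 * Num.min `|p.2 - q.2| l.2)).
    apply: eq_big_seq => p py; apply: eq_big_seq => q qy.
    rewrite cE; last first.
      rewrite DE (in_cons 0) (in_cons h); apply/orP; right; apply/orP; right.
      by apply/allpairsP; exists (p, q).
    rewrite mulr_sumr; apply: eq_bigr => l _; ring.
  under eq_bigr do rewrite exchange_big/=.
  rewrite exchange_big/=; apply: eq_bigr => l _.
  by rewrite /quad mulr_sumr; apply: eq_bigr => p _; rewrite mulr_sumr.
rewrite -sumrN [leLHS]big_seq [leRHS]big_seq.
apply: ler_sum => l /c0[l1 /andP[l2 _]].
by rewrite -mulrN ler_wpM2l// quad_min_ge.
Qed.

End concave.

(** * The covariance of fractional Brownian motion *)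

Section quad_theory.
Context {R : realType} (k : R -> R -> R).
Implicit Types x y z : seq (R * R).

Definition scale (c : R) x := [seq (c * p.1, p.2) | p <- x].

Lemma quad_catl x y z : quad k (x ++ y) z = quad k x z + quad k y z.
Proof. by rewrite /quad big_cat. Qed.

Lemma quad_catr x y z : quad k x (y ++ z) = quad k x y + quad k x z.
Proof. by rewrite /quad -big_split; apply: eq_bigr => p _; rewrite big_cat. Qed.

Lemma quad_scalel c x y : quad k (scale c x) y = c * quad k x y.
Proof.
rewrite /quad big_map mulr_sumr; apply: eq_bigr => p _.
by rewrite mulr_sumr; apply: eq_bigr => q _; rewrite !mulrA.
Qed.

Lemma quad_scaler c x y : quad k x (scale c y) = c * quad k x y.
Proof.
rewrite /quad mulr_sumr; apply: eq_bigr => p _; rewrite big_map mulr_sumr.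
by apply: eq_bigr => q _/=; ring.
Qed.

Lemma quadC x y : (forall u v, k u v = k v u) -> quad k x y = quad k y x.
Proof.
move=> kC; rewrite /quad exchange_big; apply: eq_bigr => p _.
by apply: eq_bigr => q _; rewrite kC [p.1 * _]mulrC.
Qed.

Lemma quad1 p q : quad k [:: p] [:: q] = p.1 * q.1 * k p.2 q.2.
Proof. by rewrite /quad !big_seq1. Qed.

Lemma quad_perm x y : perm_eq x y -> quad k x x = quad k y y.
Proof.
move=> xy; rewrite /quad (perm_big _ xy)/=.
by apply: eq_bigr => p _; rewrite (perm_big _ xy).
Qed.

Definition quadE := (quad_catl, quad_catr, quad_scalel, quad_scaler).

End quad_theory.

Section fbm_cov.
Context {R : realType} (H : R).
Hypothesis H0 : 0 < H.
Hypothesis H1 : H < 1 / 2.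
Implicit Types x y : seq (R * R).
Notation K := (fbm_cov H).

Lemma fbm_covC u v : K u v = K v u.
Proof. by rewrite /fbm_cov distrC [X in X - _]addrC. Qed.

(** An extra atom at 0 balances the total mass. Its interaction with a point [u >= 0] involves the
    power of the distance from [u] to 0, which reproduces the two one-variable terms of the
    covariance. *)
Lemma fbm_cov_diff x : all (fun p => 0 <= p.2) x ->
  quad K x x = - quad (fun u v => `|u - v| `^ (2 * H))
    ((- \sum_(p <- x) p.1, 0) :: x) ((- \sum_(p <- x) p.1, 0) :: x) / 2.
Proof.
move=> x0; set k := fun u v : R => _; set S := \sum_(p <- x) p.1.
pose U := \sum_(p <- x) p.1 * p.2 `^ (2 * H).
have H2 : 2 * H != 0 by rewrite gt_eqF// mulr_gt0.
have kC u v : k u v = k v u by rewrite /k distrC.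
have -> : quad k ((- S, 0) :: x) ((- S, 0) :: x) = - (2 * S * U) + quad k x x.
  rewrite -cat1s !quadE quad1 (quadC x)//.
  have -> : quad k [:: (- S, 0)] x = - S * U.
    rewrite /quad big_seq1 /U mulr_sumr; apply: eq_big_seq => p /(allP x0) p0/=.
    by rewrite /k sub0r normrN ger0_norm// -mulrA.
  rewrite /= /k subrr normr0 powR0//; ring.
have -> : quad K x x = (2 * S * U - quad k x x) / 2.
  transitivity (\sum_(p <- x) \sum_(q <- x)
    ((p.1 * p.2 `^ (2 * H) * q.1) + p.1 * (q.1 * q.2 `^ (2 * H))
     - p.1 * q.1 * k p.2 q.2) / 2).
    by apply: eq_bigr => p _; apply: eq_bigr => q _; rewrite /fbm_cov /k; field.
  under eq_bigr do rewrite -mulr_suml.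
  rewrite -mulr_suml; congr (_ / _).
  under eq_bigr do rewrite sumrB big_split/=.
  rewrite sumrB big_split/= -/(quad k x x) -!big_distrlr/= -/U -/S; ring.
by field.
Qed.

(** Local nondeterminism for linear predictors. The balancing atom at 0 is one more past point, as
    [0 <= s], and together with [x] it has total mass -1. *)
Lemma fbm_quad_ge (s h : R) x : 0 <= s -> 0 <= h -> all (fun p => 0 <= p.2 <= s) x ->
  h `^ (2 * H) / 2 <= quad K ((1, s + h) :: x) ((1, s + h) :: x).
Proof.
move=> s0 h0 xs; have xs1 : all (fun p => p.2 <= s) x.
  by apply: sub_all xs => p /andP[].
have xs2 : all (fun p => 0 <= p.2) x by apply: sub_all xs => p /andP[].
rewrite fbm_cov_diff//=; last by rewrite addr_ge0.
set S := \sum_(p <- _) p.1; rewrite ler_wpM2r//.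
rewrite (@quad_perm _ _ _ ((1, s + h) :: (- S, 0) :: x)); last first.
  by rewrite -[_ :: _ :: x]/([:: (- S, 0)] ++ [:: (1, s + h)] ++ x) perm_catCA.
have a01 : 0 < 2 * H < 1 by rewrite mulr_gt0//= mulrC -ltr_pdivlMr.
apply: quad_powR_ge => //=; first by rewrite s0.
by rewrite big_cons/= /S big_cons/=; lra.
Qed.

(** This is [fbm_quad_ge] at [s = T] and [h = 0]: the atoms of mass 1 and -1 added at [T] cancel. *)
Lemma fbm_quad_ge0 (T : R) x : 0 <= T -> all (fun p => 0 <= p.2 <= T) x ->
  0 <= quad K x x.
Proof.
move=> T0 xT; have := @fbm_quad_ge T 0 ((-1, T) :: x) T0 (lexx _).
rewrite /= T0 lexx xT powR0 ?gt_eqF ?mulr_gt0// mul0r addr0 => /(_ erefl).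
rewrite -(cat1s (1, T)) -(cat1s (-1, T)) !quadE.
have EN y : quad K [:: (-1, T)] y = - quad K [:: (1, T)] y.
  by rewrite -[RHS]mulN1r -quad_scalel /scale/= mulr1.
rewrite !(quadC x _ fbm_covC) (quadC [:: (1, T)] [:: (-1, T)] fbm_covC) !EN.
rewrite (quadC [:: (1, T)] [:: (-1, T)] fbm_covC) EN.
lra.
Qed.

End fbm_cov.

(** * Approximation by algebras of bounded functions *)

Section sign_iteration.
Context {R : realType}.

(** The Newton-Schulz polynomial for the sign: it is odd and fixes -1, 0 and 1. As a polynomial it
    can be iterated inside an algebra of functions. *)
Definition signstep (y : R) : R := (3 * y - y ^+ 3) / 2.

Lemma signstepN y : signstep (- y) = - signstep y.
Proof. by rewrite /signstep exprNn; field. Qed.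

Lemma iter_signstepN n y : iter n signstep (- y) = - iter n signstep y.
Proof. by elim: n => //= n ->; rewrite signstepN. Qed.

Lemma iter_signstep_itv n y : 0 <= y <= 1 -> y <= iter n signstep y <= 1.
Proof.
move=> /andP[y0 y1]; elim: n => [|n /=]; first by rewrite lexx y1.
set z := iter _ _ _ => /andP[yz z1]; rewrite /signstep.
have z0 : 0 <= z by lra.
(* The two products are twice [signstep z - z] and twice [1 - signstep z]. *)
have : 0 <= z * ((1 - z) * (1 + z)) by rewrite !mulr_ge0; lra.
have : 0 <= (1 - z) * ((1 - z) * (2 + z)) by rewrite !mulr_ge0; lra.
by move=> ? ?; apply/andP; split; lra.
Qed.

Lemma iter_signstep_le1 n y : `|y| <= 1 -> `|iter n signstep y| <= 1.
Proof.
have W z : 0 <= z <= 1 -> `|iter n signstep z| <= 1.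
  move=> z01; have /andP[z1 z2] := iter_signstep_itv n z01.
  by rewrite ger0_norm// (le_trans _ z1)//; case/andP: z01.
have [y0|y0] := leP 0 y; first by rewrite ger0_norm// => y1; apply: W; rewrite y0.
rewrite ltr0_norm// => y1.
by rewrite -normrN -iter_signstepN W// y1 oppr_ge0 ltW.
Qed.

Lemma cvg_iter_signstep y : `|y| <= 1 -> iter n signstep y @[n --> \oo] --> Num.sg y.
Proof.
have W z : 0 < z <= 1 -> iter n signstep z @[n --> \oo] --> (1 : R).
  move=> /andP[z0 z1].
  (* One step multiplies the gap [1 - u] by [(1 - u) * (2 + u) / 2], which is at most [1 - u / 2],
     hence at most [1 - z / 2] because the iterates stay above [z]. *)
  have bnd n : 1 - (1 - z / 2) ^+ n <= iter n signstep z.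
    elim: n => [|n IH]; first by rewrite expr0 subrr ltW.
    have /andP[i1 i2] := @iter_signstep_itv n z (introT andP (conj (ltW z0) z1)).
    rewrite iterS; set u := iter n _ _ in IH i1 i2 *.
    have : 1 - signstep u <= (1 - z / 2) * (1 - u).
      have -> : 1 - signstep u = (1 - u) * ((1 - u) * (2 + u) / 2) by rewrite /signstep; field.
      rewrite [leRHS]mulrC ler_wpM2l; nra.
    have : (1 - z / 2) * (1 - u) <= (1 - z / 2) * (1 - z / 2) ^+ n by rewrite ler_wpM2l; lra.
    rewrite exprS; lra.
  apply: (@squeeze_cvgr _ _ _ _ (fun n => 1 - (1 - z / 2) ^+ n) (fun=> 1)).
  - by apply: nearW => n; rewrite bnd; have /andP[_ ->] := @iter_signstep_itv n z
      (introT andP (conj (ltW z0) z1)).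
  - rewrite -[X in _ --> X]subr0; apply: cvgB; first exact: cvg_cst.
    by apply: cvg_expr; rewrite ger0_norm; lra.
  - exact: cvg_cst.
have [->|y0|y0] := sgrP y => y1.
- have -> : (fun n => iter n signstep 0) = (fun=> 0 : R).
    by apply/funext; elim=> //= n ->; rewrite /signstep mulr0 expr0n subrr mul0r.
  exact: cvg_cst.
- by apply: W; rewrite y0.
- have -> : (fun n => iter n signstep y) = (fun n => - iter n signstep (- y)).
    by apply/funext => n; rewrite iter_signstepN opprK.
  by apply: cvgN; apply: W; rewrite oppr_gt0 y0.
Qed.

End sign_iteration.

(** * Classes of functions closed under bounded pointwise limits *)

Section bounded_functions.
Context d (T : measurableType d) (R : realType).
Implicit Types (f g : T -> R) (K : set (T -> R)) (G : set (set T)).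

Definition bounded_mfun f :=
  measurable_fun setT f /\ exists M : R, forall w, `|f w| <= M.

Record linear_class K : Prop := LinearClass {
  class_add : forall f g, K f -> K g -> K (fun w => f w + g w) ;
  class_scale : forall c f, K f -> K (fun w => c * f w) }.

Definition bounded_limit_closed K := forall (f_ : nat -> T -> R) f (M : R),
  (forall n, K (f_ n)) -> (forall n w, `|f_ n w| <= M) ->
  (forall w, f_ n w @[n --> \oo] --> f w) -> K f.

Lemma class_sum K (I : eqType) (s : seq I) (f : I -> T -> R) : linear_class K ->
  K (fun=> 0) -> (forall i, i \in s -> K (f i)) -> K (fun w => \sum_(i <- s) f i w).
Proof.
move=> [KD KZ] K0; elim: s => [|i s IH] Kf.
  by under eq_fun do rewrite big_nil.
under eq_fun do rewrite big_cons; apply/KD; first by apply: Kf; rewrite inE eqxx.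
by apply: IH => j js; apply: Kf; rewrite inE js orbT.
Qed.

(** The sum counts the integers from 1 to [m] not exceeding [t], so it is the integer part of
    [t]. *)
Lemma staircase_bound (m : nat) (t : R) : 0 <= t <= m%:R ->
  t - 1 <= \sum_(k < m) (k.+1%:R <= t)%R%:R <= t.
Proof.
move=> /andP[t0 tm].
suff [H1 H2] : (t < m%:R -> t - 1 <= \sum_(k < m) (k.+1%:R <= t)%R%:R <= t) /\
    (m%:R <= t -> \sum_(k < m) (k.+1%:R <= t)%R%:R = m%:R :> R).
  have [/H1//|mt] := ltP t m%:R; rewrite H2//; lra.
elim: m {tm} => [|m [IH1 IH2]].
  by split=> [|_]; [lra|rewrite big_ord0].
rewrite big_ord_recr/=; split => [tm|mt].
  rewrite [X in _ + X%:R](_ : _ = 0%N) ?addr0; last by rewrite leNgt tm.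
  have [/IH1//|mt] := ltP t m%:R; rewrite IH2//.
  by move: tm; rewrite -natr1; lra.
by rewrite mt IH2 ?natr1//; move: mt; rewrite -natr1; lra.
Qed.

(** After an affine change of scale to values in [0, 1], [f] is a uniform limit of staircases, which
    are combinations of indicators of preimages of rays under [f]. *)
Lemma bounded_limit_closed_mfun K G : linear_class K -> bounded_limit_closed K ->
  (forall S, G S -> K (\1_S)) ->
  forall f, (forall A, measurable A -> G (f @^-1` A)) ->
  (exists M : R, forall w, `|f w| <= M) -> K f.
Proof.
move=> Klin Klim K1 f Gf [M0 fM0].
pose M := Num.max M0 1; have M1 : 0 < M by rewrite lt_max ltr01 orbT.
have fM w : `|f w| <= M by rewrite le_max fM0.
have [KD KZ] := Klin.
have Kone : K (fun=> 1).
  rewrite -[X in K X](_ : \1_(f @^-1` setT) = _); first by apply/K1/Gf.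
  by apply/funext => w; rewrite preimage_setT indicT.
have K0 : K (fun=> 0) by under eq_fun do rewrite -[0](mul0r 1); exact: KZ.
pose g w := (f w + M) / (2 * M).
have g01 w : 0 <= g w <= 1.
  have := fM w; rewrite ler_norml => /andP[f1 f2].
  by rewrite /g divr_ge0 ?ler_pdivrMr ?mulr_gt0//=; lra.
have fE : f = (fun w => 2 * M * g w + (- M) * 1).
  by apply/funext => w; rewrite /g; field; rewrite gt_eqF.
rewrite fE; apply: KD; last exact: KZ.
apply/KZ.
(* This is [g] rounded down to a multiple of [1 / n.+1], written through its superlevel sets. *)
pose g_ n w : R := n.+1%:R^-1 * \sum_(k < n.+1) \1_[set w | k.+1%:R <= n.+1%:R * g w] w.
have gg_ n w : `|g_ n w - g w| <= n.+1%:R^-1.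
  have n0 : 0 < n.+1%:R :> R by rewrite ltr0n.
  have /andP[g0 g1] := g01 w.
  have := @staircase_bound n.+1 (n.+1%:R * g w).
  rewrite mulr_ge0//= ler_piMr// => /(_ isT) /andP[h1 h2].
  have -> : g_ n w = n.+1%:R^-1 * \sum_(k < n.+1) (k.+1%:R <= n.+1%:R * g w)%R%:R.
    by congr (_ * _); apply: eq_bigr => k _; rewrite indicE; congr (nat_of_bool _)%:R;
       apply/idP/idP => [/set_mem//|?]; exact/mem_set.
  rewrite -(ler_pM2l n0) -{1}(gtr0_norm n0) -normrM mulrBr mulVKf ?gt_eqF// mulfV ?gt_eqF//.
  by rewrite ler_norml; lra.
apply: (Klim g_ _ 2).
- move=> n; apply/KZ; apply: class_sum => // k _; apply: K1.
  have -> : [set w | k.+1%:R <= n.+1%:R * g w] =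
      f @^-1` `[2 * M * (k.+1%:R / n.+1%:R) - M, +oo[.
    apply/seteqP; split=> w /=; rewrite in_itv/= andbT lerBlDr /g.
      rewrite -ler_pdivrMl ?ltr0n// ler_pdivlMr ?mulr_gt0//.
      by rewrite mulrC [_^-1 * _]mulrC.
    rewrite -ler_pdivrMl ?ltr0n// ler_pdivlMr ?mulr_gt0//.
    by rewrite mulrC [_^-1 * _]mulrC.
  by apply: Gf.
- move=> n w; have := gg_ n w; have /andP[g0 g1] := g01 w.
  have : n.+1%:R^-1 <= 1 :> R by rewrite invf_le1// ler1n.
  move: (_^-1) (g w) (g_ n w) g0 g1 => e u v u0 u1 e1.
  by rewrite !ler_norml => /andP[? ?]; apply/andP; split; lra.
- move=> w; apply/cvgrPdist_le => e e0; near=> n.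
  rewrite distrC (le_trans (gg_ n w))//.
  by apply/ltW; near: n; exact: (near_infty_natSinv_lt (PosNum e0)).
Unshelve. all: by end_near. Qed.
End bounded_functions.

Section bounded_mfun_theory.
Context d (T : measurableType d) (R : realType) (P : probability T R).
Implicit Types f g : T -> R.

Lemma bounded_mfun_cst c : bounded_mfun (fun _ : T => c : R).
Proof. by split => //; exists `|c|. Qed.

Lemma bounded_mfunD f g : bounded_mfun f -> bounded_mfun g ->
  bounded_mfun (fun w => f w + g w).
Proof.
move=> [mf [M fM]] [mg [N gN]]; split; first exact: measurable_funD.
by exists (M + N) => w; rewrite (le_trans (ler_normD _ _))// lerD.
Qed.

Lemma bounded_mfunM f g : bounded_mfun f -> bounded_mfun g ->
  bounded_mfun (fun w => f w * g w).
Proof.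
move=> [mf [M fM]] [mg [N gN]]; split; first exact: measurable_funM.
by exists (M * N) => w; rewrite normrM ler_pM.
Qed.

Lemma bounded_mfunZ c f : bounded_mfun f -> bounded_mfun (fun w => c * f w).
Proof. by move=> bf; apply: bounded_mfunM => //; exact: bounded_mfun_cst. Qed.

Lemma bounded_mfunB f g : bounded_mfun f -> bounded_mfun g ->
  bounded_mfun (fun w => f w - g w).
Proof.
move=> bf bg; apply: bounded_mfunD => //.
by under eq_fun do rewrite -mulN1r; exact: bounded_mfunZ.
Qed.

Lemma bounded_mfunX f : bounded_mfun f -> bounded_mfun (fun w => f w ^+ 2).
Proof. by move=> bf; under eq_fun do rewrite expr2; exact: bounded_mfunM. Qed.

Lemma bounded_mfun_lim (f_ : nat -> T -> R) f (M : R) :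
  (forall n, measurable_fun setT (f_ n)) -> (forall n w, `|f_ n w| <= M) ->
  (forall w, f_ n w @[n --> \oo] --> f w) ->
  measurable_fun setT f /\ (forall w, `|f w| <= M).
Proof.
move=> mf_ f_M ff; split.
  by apply: (@measurable_fun_cvg _ _ _ _ f_) => // w _; exact: ff.
move=> w; have h : `|f_ n w| @[n --> \oo] --> `|f w| by apply: cvg_norm; exact: ff.
rewrite -(cvg_lim _ h)//.
by apply: limr_le; [apply/cvg_ex; exists (`|f w|)|exact: nearW].
Qed.

Lemma Rintegrable_cst (c : R) : Rintegrable P (fun=> c).
Proof. exact: finite_measure_integrable_cst. Qed.

Lemma bounded_mfun_integrable f : bounded_mfun f -> Rintegrable P f.
Proof.
by move=> [mf [M fM]]; apply: (le_Rintegrable mf fM); exact: Rintegrable_cst.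
Qed.

Lemma Rintegral_le2 f g h a b : Rintegrable P f -> Rintegrable P g -> Rintegrable P h ->
  (forall w, f w <= a * g w + b * h w) ->
  \int[P]_w f w <= a * \int[P]_w g w + b * \int[P]_w h w.
Proof.
move=> fi gi hi fgh; rewrite -!RintegralZl// -RintegralD//; last 2 first.
- exact: RintegrableZ.
- exact: RintegrableZ.
by apply: le_Rintegral => //; apply: RintegrableD; exact: RintegrableZ.
Qed.

End bounded_mfun_theory.

(** * Mean-square closure of an algebra of bounded functions *)

Section L2_closure.
Context d (T : measurableType d) (R : realType) (P : probability T R).
Variable A : set (T -> R).
Hypothesis Abnd : forall f, A f -> bounded_mfun f.
Hypothesis Alin : linear_class A.
Hypothesis Amul : forall f g, A f -> A g -> A (fun w => f w * g w).
Hypothesis A1 : A (fun=> 1).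
Implicit Types f g : T -> R.

Definition L2_closure : set (T -> R) := [set f | bounded_mfun f /\
  forall e : R, 0 < e -> exists2 g, A g & \int[P]_w ((f w - g w) ^+ 2) < e].

Let sqint f g : bounded_mfun f -> bounded_mfun g ->
  Rintegrable P (fun w => (f w - g w) ^+ 2).
Proof.
by move=> ? ?; apply: bounded_mfun_integrable; apply: bounded_mfunX; exact: bounded_mfunB.
Qed.

Lemma L2_closure_sub f : A f -> L2_closure f.
Proof.
move=> Af; split=> [|e e0]; [exact: Abnd|exists f => //].
by under eq_Rintegral do rewrite subrr expr0n; rewrite Rintegral_cst// mul0r.
Qed.

Lemma L2_closureD f g : L2_closure f -> L2_closure g -> L2_closure (fun w => f w + g w).
Proof.
move=> [bf cf] [bg cg]; split=> [|e e0]; first exact: bounded_mfunD.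
have e4 : 0 < e / 4 by lra.
have [f' Af' f'e] := cf _ e4; have [g' Ag' g'e] := cg _ e4.
exists (fun w => f' w + g' w); first by case: Alin => AD _; exact: AD.
apply: (@le_lt_trans _ _ (2 * \int[P]_w ((f w - f' w) ^+ 2) +
                          2 * \int[P]_w ((g w - g' w) ^+ 2))); last by lra.
apply: Rintegral_le2.
- by apply: sqint; apply: bounded_mfunD => //; exact: Abnd.
- by apply: sqint => //; exact: Abnd.
- by apply: sqint => //; exact: Abnd.
- move=> w; have := sqr_ge0 (f w - f' w - (g w - g' w)); lra.
Qed.

(** The error splits as (f - f') g + f' (g - g'). The approximant [f'] is fixed first, because the
    accuracy asked of [g'] depends on the bound [N] of the square of [f']. *)
Lemma L2_closureM f g : L2_closure f -> L2_closure g -> L2_closure (fun w => f w * g w).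
Proof.
move=> [bf cf] [bg cg]; split=> [|e e0]; first exact: bounded_mfunM.
have bound (h : T -> R) : bounded_mfun h -> exists2 M : R, 0 < M & forall w, h w ^+ 2 <= M.
  move=> [_ [M hM]]; exists (M ^+ 2 + 1) => [|w]; first by rewrite ltr_wpDl ?sqr_ge0.
  rewrite -[leLHS]addr0 lerD// -(real_normK (num_real (h w))) ler_sqr ?nnegrE//.
  by rewrite (le_trans _ (hM w)).
have [M M0 gM] := bound _ bg.
have eM : 0 < e / (4 * M) by rewrite divr_gt0// mulr_gt0.
have [f' Af' f'e] := cf _ eM.
have [N N0 f'N] := bound _ (Abnd Af').
have eN : 0 < e / (4 * N) by rewrite divr_gt0// mulr_gt0.
have [g' Ag' g'e] := cg _ eN.
exists (fun w => f' w * g' w); first exact: Amul.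
apply: (@le_lt_trans _ _ (2 * M * \int[P]_w ((f w - f' w) ^+ 2) +
                          2 * N * \int[P]_w ((g w - g' w) ^+ 2))).
  apply: Rintegral_le2.
  - by apply: sqint; apply: bounded_mfunM => //; exact: Abnd.
  - by apply: sqint => //; exact: Abnd.
  - by apply: sqint => //; exact: Abnd.
  - move=> w.
    have -> : f w * g w - f' w * g' w = (f w - f' w) * g w + f' w * (g w - g' w) by ring.
    have H1 : (f w - f' w) ^+ 2 * g w ^+ 2 <= (f w - f' w) ^+ 2 * M by rewrite ler_wpM2l ?sqr_ge0.
    have H2 : f' w ^+ 2 * (g w - g' w) ^+ 2 <= N * (g w - g' w) ^+ 2 by rewrite ler_wpM2r ?sqr_ge0.
    have := sqr_ge0 ((f w - f' w) * g w - f' w * (g w - g' w)); lra.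
have -> : e = 2 * M * (e / (4 * M)) + 2 * N * (e / (4 * N)).
  by field; rewrite !gt_eqF.
by rewrite ltrD// ltr_pM2l// mulr_gt0.
Qed.

Lemma L2_closureZ c f : L2_closure f -> L2_closure (fun w => c * f w).
Proof.
apply: L2_closureM; rewrite -[X in L2_closure X](_ : (fun=> c * 1) = _).
  by apply: L2_closure_sub; case: Alin => _; apply.
by apply/funext => w; rewrite mulr1.
Qed.

Lemma L2_closure_linear : linear_class L2_closure.
Proof. by split; [exact: L2_closureD|exact: L2_closureZ]. Qed.

(** A bounded pointwise limit is a mean-square limit by dominated convergence, so an approximant of
    a late [f_ n] also approximates [f]. *)
Lemma L2_closure_lim : bounded_limit_closed L2_closure.
Proof.
move=> f_ f M cf_ f_M ff.
have mf_ n : measurable_fun setT (f_ n) by case: (cf_ n) => -[].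
have [mf fM] := bounded_mfun_lim mf_ f_M ff.
have bf : bounded_mfun f by split => //; exists M.
split=> // e e0.
have : \int[P]_w ((f_ n w - f w) ^+ 2) @[n --> \oo] --> \int[P]_w (0 : R).
  apply: (@Rintegral_cvg _ _ _ P _ _ (fun=> (M + M) ^+ 2)).
  - by move=> n; apply: measurable_funX; exact: measurable_funB.
  - exact: measurable_cst.
  - move=> w; have h : (f_ n w - f w) @[n --> \oo] --> (0 : R).
      by rewrite -(subrr (f w)); apply: cvgB; [exact: ff|exact: cvg_cst].
    have h2 : (f_ n w - f w) * (f_ n w - f w) @[n --> \oo] --> (0 * 0 : R) by exact: cvgM.
    by rewrite mulr0 in h2; exact: h2.
  - exact: Rintegrable_cst.
  - move=> n w; rewrite normrX ler_sqr ?nnegrE//.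
      by rewrite (le_trans (ler_normB _ _))// lerD.
    by rewrite addr_ge0// (le_trans _ (fM w)).
have e4 : 0 < e / 4 by lra.
rewrite Rintegral_cst// mul0r => /cvgrPdist_lt/(_ _ e4)[n _ /(_ n (leqnn _))].
rewrite /= sub0r normrN ger0_norm; last by apply: Rintegral_ge0 => w _; exact: sqr_ge0.
move=> ne; case: (cf_ n) => bfn /(_ _ e4)[g Ag ge]; exists g => //.
apply: (@le_lt_trans _ _ (2 * \int[P]_w ((f_ n w - f w) ^+ 2) +
                          2 * \int[P]_w ((f_ n w - g w) ^+ 2))); last by lra.
apply: Rintegral_le2.
- by apply: sqint => //; exact: Abnd.
- exact: sqint.
- by apply: sqint => //; exact: Abnd.
- move=> w; have := sqr_ge0 (f_ n w - f w + (f_ n w - g w)); lra.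
Qed.

(** Products give finite unions by inclusion-exclusion; a countable union is the bounded pointwise
    limit of finite ones. *)
Lemma L2_closure_sigma_algebra : sigma_algebra setT [set S | L2_closure (\1_S)].
Proof.
have [KD KZ] := L2_closure_linear.
have K0 : L2_closure (fun=> 0).
  by under eq_fun do rewrite -[0](mul0r 1); apply/KZ; exact: L2_closure_sub.
have KU S S' : L2_closure \1_S -> L2_closure \1_S' -> L2_closure \1_(S `|` S').
  move=> KS KS'; rewrite [X in L2_closure X](_ : _ =
     (fun w => \1_S w + (\1_S' w + (-1) * (\1_S w * \1_S' w)))).
    by apply/KD => //; apply/KD => //; apply/KZ; exact: L2_closureM.
  apply/funext => w; rewrite !indicE in_setU.
  by case: (w \in S); case: (w \in S'); rewrite /=; lra.
split=> /=.
- by rewrite indic0.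
- move=> S KS; rewrite setTD [X in L2_closure X](_ : _ = (fun w => 1 + (-1) * \1_S w)).
    by apply/KD; [exact: L2_closure_sub|exact/KZ].
  by apply/funext => w; rewrite !indicE in_setC; case: (w \in S); rewrite /=; lra.
- move=> F KF; pose F' n := \big[setU/set0]_(i < n) F i.
  apply: (@L2_closure_lim (fun n => \1_(F' n)) _ 1).
  + elim=> [|n IH]; rewrite /F' ?big_ord0 ?big_ord_recr/= ?indic0//.
    exact: KU.
  + by move=> n w; rewrite indicE; case: (_ \in _); rewrite ?normr0 ?normr1.
  + move=> w; apply: cvg_near_cst.
    have [[k _ Fk]|nF] := pselect ((\bigcup_i F i) w).
      exists k.+1 => // n /= kn; rewrite !indicE; congr (nat_of_bool _)%:R.
      rewrite !mem_set//; first by exists k.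
      by rewrite /F' -bigcup_mkord; exists k.
    apply: nearW => n; rewrite !indicE !memNset//.
    by rewrite /F' -bigcup_mkord => -[i _ Fi]; apply: nF; exists i.
Qed.

Lemma L2_closure_sgn f : (forall w, `|f w| <= 1) -> L2_closure f ->
  L2_closure (fun w => Num.sg (f w)).
Proof.
move=> f1 cf; apply: (@L2_closure_lim (fun n w => iter n signstep (f w)) _ 1).
- elim=> [//|n IH]; rewrite [X in L2_closure X](_ : _ = (fun w =>
     3 / 2 * iter n signstep (f w) + (- 2^-1) * (iter n signstep (f w) *
      (iter n signstep (f w) * iter n signstep (f w))))).
    apply: L2_closureD; first exact: L2_closureZ.
    by apply: L2_closureZ; do 2 apply: L2_closureM => //.
  by apply/funext => w /=; rewrite /signstep; field.
- by move=> n w; exact: iter_signstep_le1.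
- by move=> w; exact: cvg_iter_signstep.
Qed.

(** The weighted inequality (a + b)^2 <= (1 + t) a^2 + (1 + 1/t) b^2 transfers the bound from an
    approximant [W] of [Z] to [Z] with arbitrarily small loss. *)
Lemma L2_closure_dist_ge (X : T -> R) (c : R) : measurable_fun setT X ->
  Rintegrable P (fun w => X w ^+ 2) ->
  (forall W, A W -> c <= \int[P]_w ((X w - W w) ^+ 2)) ->
  forall Z, L2_closure Z -> c <= \int[P]_w ((X w - Z w) ^+ 2).
Proof.
move=> mX iX cA Z [bZ clZ]; set J := \int[P]_w _.
have J0 : 0 <= J by apply: Rintegral_ge0 => w _; exact: sqr_ge0.
have iXf f : bounded_mfun f -> Rintegrable P (fun w => (X w - f w) ^+ 2).
  move=> bf; apply: (@le_Rintegrable _ _ _ P _ (fun w => 2 * X w ^+ 2 + 2 * f w ^+ 2)).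
  - by apply: measurable_funX; apply: measurable_funB => //; case: bf.
  - by move=> w; rewrite ger0_norm ?sqr_ge0//; have := sqr_ge0 (X w + f w); lra.
  - by apply: RintegrableD; apply: RintegrableZ => //; apply: bounded_mfun_integrable;
      exact: bounded_mfunX.
apply/ler_addgt0Pr => e e0.
(* With approximation error [t ^+ 2] the total loss is [t * J + t ^+ 2 + t], at most [t * (J + 2)]
   when [t <= 1]. *)
pose t := Num.min 1 (e / (J + 2)).
have J2 : 0 < J + 2 by lra.
have t0 : 0 < t by rewrite lt_min ltr01 divr_gt0.
have t1 : t <= 1 by rewrite ge_min lexx.
have te : t * (J + 2) <= e by rewrite -ler_pdivlMr// ge_min lexx orbT.
have [W AW We] := clZ (t ^+ 2) (exprn_gt0 _ t0).
apply: (@le_trans _ _ ((1 + t) * J + (1 + t^-1) * t ^+ 2)).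
  apply: (le_trans (cA _ AW)).
  apply: (@le_trans _ _ ((1 + t) * J + (1 + t^-1) * \int[P]_w ((Z w - W w) ^+ 2))); last first.
    by rewrite lerD2l ler_wpM2l ?(ltW We)// addr_ge0// invr_ge0 ltW.
  apply: Rintegral_le2; [exact/iXf/Abnd|exact: iXf|by apply: sqint => //; exact: Abnd|move=> w].
  have : 0 <= t^-1 * (t * (X w - Z w) - (Z w - W w)) ^+ 2.
    by rewrite mulr_ge0 ?sqr_ge0// invr_ge0 ltW.
  have -> : t^-1 * (t * (X w - Z w) - (Z w - W w)) ^+ 2 =
    (1 + t) * (X w - Z w) ^+ 2 + (1 + t^-1) * (Z w - W w) ^+ 2 - (X w - W w) ^+ 2.
    by field; rewrite gt_eqF.
  by rewrite subr_ge0.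
have -> : (1 + t^-1) * t ^+ 2 = t ^+ 2 + t by field; rewrite gt_eqF.
have : t ^+ 2 <= t by rewrite expr2 ler_piMr// ltW.
lra.
Qed.

End L2_closure.

(** * Gaussian linear combinations *)

Section normal_second_moment.
Context {R : realType}.
Notation mu := (@lebesgue_measure R).
Let nu : probability (measurableTypeR R) R := normal_prob 0 (1 : R).

(** The Radon-Nikodym derivative of the normal law agrees almost everywhere with the explicit
    density, as both have the same integrals over measurable sets. *)
Lemma ge0_integral_normal_prob (m s : R) (f : R -> \bar R) :
  (forall x, 0 <= f x)%E -> measurable_fun setT f ->
  (\int[normal_prob m s]_x f x = \int[mu]_x (f x * (normal_pdf m s x)%:E))%E.
Proof.
move=> f0 mf; have dom := @normal_prob_dominates R m s.
rewrite -(Radon_Nikodym_SigmaFinite.change_of_variables dom)//.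
have mpdf : measurable_fun setT (EFin \o normal_pdf m s).
  by apply/measurable_EFinP; exact: measurable_normal_pdf.
apply: ae_eq_integral => //.
- apply: emeasurable_funM => //.
  exact: (measurable_int _ (Radon_Nikodym_SigmaFinite.f_integrable dom)).
- exact: emeasurable_funM.
apply: ae_eqe_mul2l; apply: integral_ae_eq => //.
- exact: Radon_Nikodym_SigmaFinite.f_integrable.
- by move=> E _ mE; rewrite -Radon_Nikodym_SigmaFinite.f_integral.
Qed.

Lemma normal_sqr_lty : (\int[nu]_x (x ^+ 2)%:E < +oo)%E.
Proof.
rewrite ge0_integral_normal_prob; last 2 first.
- by move=> x; rewrite lee_fin sqr_ge0.
- by apply/measurable_EFinP; exact: measurable_funX.
(* The integrand is dominated by [C] times the normal density of standard deviation 2: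
   [3 / 8 * x ^+ 2] is at most its own exponential, and 1/2 = 1/8 + 3/8 in the exponents. The ratio
   of peaks exchanges the normalizations. *)
pose C := 8 / 3 * normal_peak 1 / normal_peak 2 : R.
have p2 : 0 < normal_peak 2 :> R by apply: normal_peak_gt0; rewrite pnatr_eq0.
have p1 : 0 < normal_peak 1 :> R by apply: normal_peak_gt0; rewrite oner_eq0.
have C0 : 0 <= C by apply: divr_ge0; [apply: mulr_ge0 => //; exact: ltW|exact: ltW].
apply: (@le_lt_trans _ _ (\int[mu]_x (C%:E * (normal_pdf 0 2 x)%:E))%E).
  apply: ge0_le_integral => //.
  - by move=> x _; rewrite lee_fin mulr_ge0 ?sqr_ge0 ?normal_pdf_ge0.
  - apply: emeasurable_funM; apply/measurable_EFinP; first exact: measurable_funX.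
    exact: measurable_normal_pdf.
  - by apply: measurable_funeM; apply/measurable_EFinP; exact: measurable_normal_pdf.
  move=> x _; rewrite lee_fin !normal_pdfE ?pnatr_eq0 ?oner_eq0//.
  have -> : C * (normal_peak 2 * normal_fun 0 2 x) =
      normal_peak 1 * (8 / 3 * normal_fun 0 2 x) by rewrite /C; field; rewrite gt_eqF.
  rewrite mulrCA ler_pM2l// /normal_fun subr0 expr1n.
  have -> : - x ^+ 2 / (2 ^+ 2 *+ 2) = - x ^+ 2 / (1 *+ 2) + 3 / 8 * x ^+ 2 by field.
  rewrite expRD mulrCA [leLHS]mulrC ler_pM2l ?expR_gt0//.
  have := expR_ge1Dx (3 / 8 * x ^+ 2); lra.
rewrite integralZl//; last exact: integrable_normal_pdf.
by rewrite integral_normal_pdf mule1 ltry.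
Qed.

(** Otherwise the law would be concentrated at 0, a Lebesgue null set, against absolute
    continuity. *)
Lemma normal_sqr_gt0 : (0 < \int[nu]_x (x ^+ 2)%:E)%E.
Proof.
have sq0 (x : R) : (0 <= (x ^+ 2)%:E)%E by rewrite lee_fin sqr_ge0.
rewrite lt0e integral_ge0 ?andbT//; apply/eqP => m0.
have [N [mN N0 subN]] : ae_eq nu setT (fun x : R => (x ^+ 2)%:E) (cst 0%E).
  apply/ae_eq_integral_abs => //.
    by apply/measurable_EFinP; exact: measurable_funX.
  by rewrite -[RHS]m0; apply: eq_integral => x _; rewrite gee0_abs.
have nu0 : nu [set (0%R : R)] = 0%E.
  have /null_content_dominatesP := @normal_prob_dominates R 0 1.
  by apply => //; exact: lebesgue_measure_set1.
have : (nu setT <= nu ([set (0%R : R)] `|` N))%E.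
  apply: le_measure; rewrite ?inE//; first exact: measurableU.
  move=> x _; have [->|x0] := eqVneq x 0; [by left|right].
  apply: subN => /= /(_ I) /eqP; rewrite eqe sqrf_eq0; exact/negP.
have : (nu ([set (0%R : R)] `|` N) <= nu [set (0%R : R)] + nu N)%E by exact: measureU2.
by rewrite nu0 N0 adde0 probability_setT => h /le_trans/(_ h); rewrite lee_fin ler10.
Qed.

Lemma normal_second_moment : exists2 m2 : R, 0 < m2 &
  (\int[normal_prob 0 (1 : R)]_x (x ^+ 2)%:E = m2%:E)%E.
Proof.
have := normal_sqr_gt0; have := normal_sqr_lty; rewrite /nu/=.
case: (integral _ _ _) => [r| |]//.
by rewrite lte_fin => _ r0; exists r.
Qed.

Lemma integral_sqr_normal d (Omega : measurableType d) (P : probability Omega R)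
    (X : Omega -> R) : measurable_fun setT X ->
  (forall A : set R, measurable A -> P (X @^-1` A) = normal_prob 0 1 A) ->
  (\int[P]_w (X w ^+ 2)%:E = \int[normal_prob 0%R (1%R : R)]_x (x ^+ 2)%:E)%E.
Proof.
move=> mX XE; pose X' : Omega -> measurableTypeR R := X.
have mX' : measurable_fun setT X' by exact: mX.
transitivity (\int[pushforward P X']_x (x ^+ 2)%:E)%E.
  rewrite ge0_integral_pushforward//.
  - by apply/measurable_EFinP; exact: measurable_funX.
  - by move=> u _; rewrite lee_fin sqr_ge0.
by apply: eq_measure_integral => A mA _; exact: XE.
Qed.

End normal_second_moment.

(** * Recovering a real number from sines of its small multiples *)

Section sin_bounds.
Context {R : realType}.

Lemma abs_sin_le (x : R) : `|sin x| <= `|x|.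
Proof.
have W (y : R) : 0 <= y -> `|sin y| <= y.
  move=> y0; have [|c _] := @MVT_segment R sin cos 0 y y0.
    by apply: continuous_subspaceT => z; exact: continuous_sin.
  by rewrite sin0 !subr0 => ->; rewrite normrM (ger0_norm y0) ler_piMl// cos_max.
have [x0|x0] := leP 0 x; first by rewrite (ger0_norm x0) W.
by rewrite -normrN -sinN (ltr0_norm x0) W// oppr_ge0 ltW.
Qed.

(** The mean value theorem is applied twice, to the sine on [[0, y]] and then to the cosine on
    [[0, c]]. *)
Lemma abs_sin_sub_le (x : R) : `|sin x - x| <= x ^+ 2.
Proof.
have W (y : R) : 0 <= y -> `|sin y - y| <= y ^+ 2.
  move=> y0; have [|c] := @MVT_segment R sin cos 0 y y0.
    by apply: continuous_subspaceT => z; exact: continuous_sin.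
  rewrite in_itv/= => /andP[c0 cy]; rewrite sin0 !subr0 => ->.
  have [|b] := @MVT_segment R cos (fun z => - sin z) 0 c c0.
    by apply: continuous_subspaceT => z; exact: continuous_cos.
  rewrite cos0 !subr0 => _ cE.
  have -> : cos c * y - y = (cos c - 1) * y by ring.
  rewrite cE mulNr normrM normrN normrM (ger0_norm y0) expr2 ler_wpM2r//.
  by rewrite (ger0_norm c0) (le_trans _ cy)// ler_piMl// sin_max.
have [x0|x0] := leP 0 x; first exact: W.
by have := W (- x); rewrite oppr_ge0 sinN sqrrN opprK addrC distrC; apply; exact: ltW.
Qed.

Lemma cvg_nat_sin (x : R) : n.+1%:R * sin (n.+1%:R^-1 * x) @[n --> \oo] --> x.
Proof.
apply/cvgrPdist_le => e e0.
have e'0 : 0 < e / (x ^+ 2 + 1) by rewrite divr_gt0// ltr_wpDl ?sqr_ge0.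
near=> n.
have n0 : 0 < n.+1%:R :> R by rewrite ltr0n.
rewrite distrC -[X in _ - X](mulVKf (lt0r_neq0 n0)) -mulrBr normrM (gtr0_norm n0).
apply: (@le_trans _ _ (n.+1%:R * (n.+1%:R^-1 * x) ^+ 2)).
  by rewrite ler_pM2l// abs_sin_sub_le.
have -> : n.+1%:R * (n.+1%:R^-1 * x) ^+ 2 = n.+1%:R^-1 * x ^+ 2.
  by field; rewrite gt_eqF.
have : n.+1%:R^-1 < e / (x ^+ 2 + 1) by near: n; exact: (near_infty_natSinv_lt (PosNum e'0)).
rewrite ltr_pdivlMr ?ltr_wpDl ?sqr_ge0// mulrDr mulr1.
have : 0 < n.+1%:R^-1 :> R by rewrite invr_gt0.
by move: (n.+1%:R^-1) (x ^+ 2) => u v u0 uv; lra.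
Unshelve. all: by end_near. Qed.

End sin_bounds.

(** * Orthogonal projection for a nonnegative quadratic form *)

Section projection.
Context {R : realType} (k : R -> R -> R).
Implicit Types x y v : seq (R * R).

Definition supported (q : pred R) x := all (fun p => q p.2) x.

Lemma supported_cat q x y : supported q (x ++ y) = supported q x && supported q y.
Proof. exact: all_cat. Qed.

Lemma supported_scale q c x : supported q (scale c x) = supported q x.
Proof. by rewrite /supported all_map. Qed.

Variable q : pred R.
Hypothesis kC : forall u v : R, k u v = k v u.
Hypothesis quad_ge0 : forall x, supported q x -> 0 <= quad k x x.

Lemma quad_degenerate x y : supported q x -> supported q y ->
  quad k x x = 0 -> quad k x y = 0.
Proof.
move=> qx qy x0; apply/eqP/negPn/negP => b0.
(* As [x] has zero norm, the form at [y] plus [c] times [x] is affine in [c]; this [c] gives it the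
   value -1. *)
pose c := - ((quad k y y + 1) / (2 * quad k x y)).
have := @quad_ge0 (y ++ scale c x).
rewrite supported_cat supported_scale qx qy !quadE x0 (quadC y x kC) => /(_ isT).
have -> : quad k y y + c * quad k x y + (c * quad k x y + c * (c * 0)) = -1.
  by rewrite /c; field.
by rewrite oppr_ge0 ler10.
Qed.

(* The second conjunct says that L lies in the span of l. *)
Lemma quad_projection (l : seq (seq (R * R))) x :
  (forall v, v \in l -> supported q v) -> supported q x ->
  exists L, [/\ forall q', (forall v, v \in l -> supported q' v) -> supported q' L,
    (forall y, (forall v, v \in l -> quad k y v = 0) -> quad k y L = 0) &
    (forall v, v \in l -> quad k (x ++ scale (-1) L) v = 0)].
Proof.
elim: l x => [|v l IH] x lq xq.
  exists [::]; split => // y _; rewrite /quad big1// => p _; exact: big_nil.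
have vq : supported q v by apply: lq; rewrite inE eqxx.
have lq' u : u \in l -> supported q u by move=> ul; apply: lq; rewrite inE ul orbT.
have [Lv [sLv spLv oLv]] := IH v lq' vq.
have [Lx [sLx spLx oLx]] := IH x lq' xq.
(* A Gram-Schmidt step: [v'] and [x'] are the residuals of [v] and [x] off the span of [l]. *)
set v' := v ++ scale (-1) Lv in oLv; set x' := x ++ scale (-1) Lx in oLx.
have v'q : supported q v' by rewrite supported_cat supported_scale vq sLv.
have x'q : supported q x' by rewrite supported_cat supported_scale xq sLx.
have v'E y : quad k y v' = quad k y v - quad k y Lv by rewrite !quadE mulN1r.
have x'v : quad k x' v' = quad k x' v by rewrite v'E (spLv _ oLx) subr0.
have v'v : quad k v' v' = quad k v' v by rewrite v'E (spLv _ oLv) subr0.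
(* If [v'] has zero norm it is orthogonal to everything by [quad_degenerate], and [Lx] already
   serves. *)
have [v0|v0] := eqVneq (quad k v' v') 0.
  exists Lx; split=> [q' q'l|y yl|u].
  - by apply: sLx => u ul; apply: q'l; rewrite inE ul orbT.
  - by apply: spLx => u ul; apply: yl; rewrite inE ul orbT.
  - rewrite inE => /predU1P[->|]; last exact: oLx.
    by rewrite -/x' -x'v (quadC _ _ kC) quad_degenerate.
pose c := quad k x' v' / quad k v' v'.
exists (Lx ++ scale c v'); split=> [q' q'l|y yl|u].
- have q'l' u : u \in l -> supported q' u by move=> ul; apply: q'l; rewrite inE ul orbT.
  rewrite !supported_cat !supported_scale supported_cat supported_scale sLx// sLv// andbT.
  by apply: q'l; rewrite inE eqxx.
- have yl' u : u \in l -> quad k y u = 0 by move=> ul; apply: yl; rewrite inE ul orbT.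
  by rewrite quad_catr quad_scaler v'E spLx// spLv// yl ?inE ?eqxx// subr0 mulr0 addr0.
- have -> : quad k (x ++ scale (-1) (Lx ++ scale c v')) u = quad k x' u - c * quad k v' u.
    by rewrite /scale map_cat -!/(scale _ _) !quadE; ring.
  rewrite inE => /predU1P[->|ul]; last by rewrite oLx// oLv// mulr0 subr0.
  by rewrite -v'v -x'v /c divfK// subrr.
Qed.

End projection.

(** * Linear combinations of the process and their moments *)

Section gaussian.
Context d (Omega : measurableType d) (R : realType) (P : probability Omega R).
Variables (H T : R) (B : R -> Omega -> R).
Hypothesis H0 : 0 < H.
Hypothesis H1 : H < 1 / 2.
Hypothesis T0 : 0 < T.
Hypothesis fBm : is_fBm P H T B.
Implicit Types x y v : seq (R * R).
Notation Q := (quad (fbm_cov H)).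

Definition lin x (w : Omega) : R := \sum_(p <- x) p.1 * B p.2 w.

Let onT : pred R := fun u => 0 <= u <= T.

Lemma lin_cat x y w : lin (x ++ y) w = lin x w + lin y w.
Proof. exact: big_cat. Qed.

Lemma lin_scale c x w : lin (scale c x) w = c * lin x w.
Proof. by rewrite /lin big_map mulr_sumr; apply: eq_bigr => p _; rewrite mulrA. Qed.

Lemma measurable_lin x : measurable_fun setT (lin x).
Proof.
have [mB _ _] := fBm; rewrite /lin; elim: x => [|p x IH].
  by under eq_fun do rewrite big_nil; exact: measurable_cst.
under eq_fun do rewrite big_cons.
by apply: measurable_funD => //; exact: measurable_funM.
Qed.

Lemma Q_ge0 x : supported onT x -> 0 <= Q x x.
Proof. by move=> xT; apply: (@fbm_quad_ge0 _ _ H0 H1 T) => //; exact: ltW. Qed.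

Lemma lin_gaussian x : supported onT x -> centered_gaussian P (lin x) (Q x x).
Proof.
move=> xT; have [_ _ /(_ (size x) (fun i => (tnth (in_tuple x) i).2)
   (fun i => (tnth (in_tuple x) i).1))] := fBm.
have -> : (fun w => \sum_(i < size x) (tnth (in_tuple x) i).1 *
   B (tnth (in_tuple x) i).2 w) = lin x.
  by apply/funext => w; rewrite /lin [RHS]big_tnth.
have <- : Q x x = \sum_(i < size x) \sum_(j < size x) (tnth (in_tuple x) i).1 *
   (tnth (in_tuple x) j).1 * fbm_cov H (tnth (in_tuple x) i).2 (tnth (in_tuple x) j).2.
  by rewrite /quad [LHS]big_tnth; apply: eq_bigr => i _; rewrite [LHS]big_tnth.
by apply => i; have /allP/(_ _ (mem_tnth i (in_tuple x))) := xT.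
Qed.

Lemma lin_law x y (f : R -> R) : supported onT x -> supported onT y -> Q x x = Q y y ->
  bounded_mfun f -> \int[P]_w f (lin x w) = \int[P]_w f (lin y w).
Proof.
move=> xT yT xy [mf [M fM]].
have transfer z : \int[P]_w f (lin z w) =
    fine (\int[pushforward P (lin z)]_u (f u)%:E)%E.
  rewrite integral_pushforward//.
  - exact: measurable_lin.
  - exact/measurable_EFinP.
  - rewrite preimage_setT; apply: (@bounded_mfun_integrable _ _ _ P (f \o lin z)).
    split; last by exists M => w; exact: fM.
    by apply: measurableT_comp => //; exact: measurable_lin.
rewrite !transfer; congr fine.
apply: eq_measure_integral; [exact: measurable_lin..|move=> mx my A mA _].
have E : P (lin x @^-1` A) = P (lin y @^-1` A).
  by rewrite (lin_gaussian xT mA) (lin_gaussian yT mA) xy.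
exact: E.
Qed.

Variable m2 : R.
Hypothesis m2E : (\int[normal_prob 0 (1 : R)]_x (x ^+ 2)%:E = m2%:E)%E.

(** Dividing by the standard deviation reduces to the standard normal law; zero variance gives the
    Dirac mass at 0. *)
Lemma integral_lin_sqr x : supported onT x ->
  (\int[P]_w (lin x w ^+ 2)%:E = (m2 * Q x x)%:E)%E.
Proof.
move=> xT.
have transfer z : (\int[P]_w (lin z w ^+ 2)%:E =
    \int[pushforward P (lin z)]_u (u ^+ 2)%:E)%E.
  rewrite ge0_integral_pushforward//.
  - exact: measurable_lin.
  - by apply/measurable_EFinP; exact: measurable_funX.
  - by move=> u _; rewrite lee_fin sqr_ge0.
have := Q_ge0 xT; rewrite le_eqVlt => /predU1P[/esym q0|q0].
  rewrite transfer q0 mulr0; transitivity (\int[\d_(0%R : R)]_u (u ^+ 2)%:E)%E.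
    apply: eq_measure_integral; first exact: measurable_lin.
    move=> mx A mA _.
    have E : P (lin x @^-1` A) = \d_(0 : R) A by rewrite (lin_gaussian xT mA) q0 eqxx.
    exact: E.
  rewrite integral_dirac//; last by apply/measurable_EFinP; exact: measurable_funX.
  by rewrite expr0n mule0.
pose c := Num.sqrt (Q x x).
have c0 : 0 < c by rewrite sqrtr_gt0.
have c2 : c ^+ 2 = Q x x by rewrite sqr_sqrtr// ltW.
pose y := scale c^-1 x.
have yT : supported onT y by rewrite supported_scale.
have y1 : Q y y = 1 by rewrite /y !quadE -c2; field; rewrite gt_eqF.
transitivity ((c ^+ 2)%:E * \int[P]_w (lin y w ^+ 2)%:E)%E.
  rewrite -ge0_integralZl//.
  - apply: eq_integral => w _; rewrite -EFinM; congr (_%:E).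
    by rewrite /y lin_scale; field; rewrite gt_eqF.
  - by apply/measurable_EFinP/measurable_funX; exact: measurable_lin.
  - by move=> w _; rewrite lee_fin sqr_ge0.
  - by rewrite lee_fin sqr_ge0.
rewrite integral_sqr_normal; last 2 first.
- exact: measurable_lin.
- by move=> A mA; rewrite (lin_gaussian yT mA) y1 oner_eq0 sqrtr1.
by rewrite m2E -EFinM c2 mulrC.
Qed.

Lemma lin_sqr_integrable x : supported onT x -> Rintegrable P (fun w => lin x w ^+ 2).
Proof.
move=> xT; apply/integrableP; split.
  by apply/measurable_EFinP/measurable_funX; exact: measurable_lin.
under eq_integral do rewrite /= normrX real_normK ?num_real//.
by rewrite integral_lin_sqr// ltry.
Qed.

Lemma Rintegral_lin_sqr x : supported onT x -> \int[P]_w (lin x w ^+ 2) = m2 * Q x x.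
Proof. by move=> xT; rewrite /Rintegral integral_lin_sqr. Qed.

(** Polarization, which reduces mixed moments to second moments. *)
Let lin_mulE x y w : lin x w * lin y w = 4^-1 * (lin (x ++ y) w ^+ 2) -
  4^-1 * (lin (x ++ scale (-1) y) w ^+ 2).
Proof. by rewrite !lin_cat lin_scale; field. Qed.

Lemma lin_mul_integrable x y : supported onT x -> supported onT y ->
  Rintegrable P (fun w => lin x w * lin y w).
Proof.
move=> xT yT; rewrite (funext (lin_mulE x y)).
by apply: RintegrableB; apply: RintegrableZ; apply: lin_sqr_integrable;
  rewrite supported_cat ?supported_scale xT.
Qed.

Lemma Rintegral_lin_mul x y : supported onT x -> supported onT y ->
  \int[P]_w (lin x w * lin y w) = m2 * Q x y.
Proof.
move=> xT yT; under eq_Rintegral do rewrite lin_mulE.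
have xyT : supported onT (x ++ y) by rewrite supported_cat xT.
have xyT' : supported onT (x ++ scale (-1) y) by rewrite supported_cat supported_scale xT.
rewrite RintegralB//; [|by apply: RintegrableZ; exact: lin_sqr_integrable..].
rewrite !RintegralZl//; [|exact: lin_sqr_integrable..].
by rewrite !Rintegral_lin_sqr// !quadE (quadC y x (fbm_covC H)); field.
Qed.

Lemma lin_integrable x : supported onT x -> Rintegrable P (lin x).
Proof.
move=> xT; apply: (@le_Rintegrable _ _ _ P _ (fun w => 1 + lin x w ^+ 2)).
- exact: measurable_lin.
- move=> w; rewrite -(real_normK (num_real (lin x w))).
  by have := sqr_ge0 (`|lin x w| - 1); have := normr_ge0 (lin x w); nra.
- by apply: RintegrableD; [exact: Rintegrable_cst|exact: lin_sqr_integrable].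
Qed.

Lemma bounded_mfun_trig (f : R -> R) x (a : R) : continuous f -> (forall u, `|f u| <= 1) ->
  bounded_mfun (fun w => f (lin x w + a)).
Proof.
move=> cf f1; split; last by exists 1 => w.
apply: (@measurableT_comp _ _ _ _ _ _ f _ (fun w => lin x w + a)).
  exact: continuous_measurable_fun.
by apply: measurable_funD => //; exact: measurable_lin.
Qed.

Lemma bounded_mfun_cos x (a : R) : bounded_mfun (fun w => cos (lin x w + a)).
Proof. by apply: bounded_mfun_trig; [exact: continuous_cos|exact: cos_max]. Qed.

Lemma bounded_mfun_sin x (a : R) : bounded_mfun (fun w => sin (lin x w + a)).
Proof. by apply: bounded_mfun_trig; [exact: continuous_sin|exact: sin_max]. Qed.

(* When x and v are uncorrelated, c x + v and - c x + v have the same law; the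
   difference of the expectations of their cosines is that of a product of sines. *)
Lemma sin_sin_orthogonal x v (a c : R) : supported onT x -> supported onT v -> Q x v = 0 ->
  \int[P]_w (sin (c * lin x w) * sin (lin v w + a)) = 0.
Proof.
move=> xT vT xv.
have yT b : supported onT (scale b x ++ v) by rewrite supported_cat supported_scale xT.
have law : \int[P]_w cos (lin (scale c x ++ v) w + a) =
    \int[P]_w cos (lin (scale (- c) x ++ v) w + a).
  apply: (@lin_law _ _ (fun u => cos (u + a))) => //.
    by rewrite !quadE (quadC v x (fbm_covC H)) xv; ring.
  split; last by exists 1 => u; exact: cos_max.
  apply: continuous_measurable_fun => u.
  apply: (@continuous_comp _ _ _ (fun z : R => z + a) cos); last exact: continuous_cos.
  by apply: cvgD; [exact: cvg_id|exact: cvg_cst].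
have cosi y : Rintegrable P (fun w => cos (lin y w + a)).
  by apply: bounded_mfun_integrable; exact: bounded_mfun_cos.
transitivity (\int[P]_w (2^-1 * cos (lin (scale (- c) x ++ v) w + a) -
    2^-1 * cos (lin (scale c x ++ v) w + a))).
  apply: eq_Rintegral => w _; rewrite !lin_cat !lin_scale -!addrA !cosD mulNr cosN sinN.
  by field.
rewrite RintegralB//; [|exact: RintegrableZ..].
by rewrite !(RintegralZl _ measurableT (cosi _)) law subrr.
Qed.

(** The first factor is the limit of [n.+1%:R * sin (n.+1%:R^-1 * lin x w)], dominated by its
    absolute value; each of these is covered by [sin_sin_orthogonal]. *)
Lemma lin_sin_orthogonal x v (a : R) : supported onT x -> supported onT v -> Q x v = 0 ->
  \int[P]_w (lin x w * sin (lin v w + a)) = 0.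
Proof.
move=> xT vT xv; have [msin _] := bounded_mfun_sin v a.
have mx c : measurable_fun setT (fun w => sin (c * lin x w)).
  have [+ _] := bounded_mfun_sin (scale c x) 0.
  by under eq_fun do rewrite lin_scale addr0.
pose f_ n w := n.+1%:R * sin (n.+1%:R^-1 * lin x w) * sin (lin v w + a).
have f_0 n : \int[P]_w f_ n w = 0.
  rewrite /f_; under eq_Rintegral do rewrite -mulrA.
  rewrite RintegralZl ?sin_sin_orthogonal ?mulr0//.
  apply: bounded_mfun_integrable; apply: bounded_mfunM; last exact: bounded_mfun_sin.
  by split => //; exists 1 => w; exact: sin_max.
have : \int[P]_w f_ n w @[n --> \oo] --> \int[P]_w (lin x w * sin (lin v w + a)).
  apply: (@Rintegral_cvg _ _ _ P _ _ (fun w => `|lin x w|)).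
  - by move=> n; apply: measurable_funM => //; exact: measurable_funM.
  - by apply: measurable_funM => //; exact: measurable_lin.
  - by move=> w; apply: cvgM; [exact: cvg_nat_sin|exact: cvg_cst].
  - by apply: integrable_norm; exact: lin_integrable.
  - move=> n w; rewrite normrM (@le_trans _ _ (`|n.+1%:R * sin (n.+1%:R^-1 * lin x w)|))//.
      by rewrite ler_piMr// sin_max.
    have n0 : 0 < n.+1%:R :> R by rewrite ltr0n.
    rewrite normrM (gtr0_norm n0) -ler_pdivlMl//.
    by rewrite (le_trans (abs_sin_le _))// normrM ger0_norm// invr_ge0 ltW.
under eq_fun do rewrite f_0.
by move/cvg_lim => <-//; rewrite lim_cst.
Qed.

(** * Trigonometric polynomials in the past of the process *)

Definition past (s : R) : pred R := fun u => 0 <= u <= s.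

(** An entry lists amplitude, phase and linear combination. The free phase covers sines as well, and
    lets the product-to-sum formula stay within cosines. *)
Definition trig_poly (s : R) : set (Omega -> R) := [set f |
  exists zs : seq (R * (R * seq (R * R))),
    (forall z, z \in zs -> supported (past s) z.2.2) /\
    f = fun w => \sum_(z <- zs) z.1 * cos (lin z.2.2 w + z.2.1)].

Section trig_poly.
Variable s : R.

Lemma trig_poly_cos b a v : supported (past s) v ->
  trig_poly s (fun w => b * cos (lin v w + a)).
Proof.
move=> vs; exists [:: (b, (a, v))]; split; first by move=> z; rewrite inE => /eqP ->.
by apply/funext => w; rewrite big_seq1.
Qed.

Lemma trig_poly_linear : linear_class (trig_poly s).
Proof.
split=> [f g [zs [zss ->]] [zs' [zss' ->]]|c f [zs [zss ->]]].
  exists (zs ++ zs'); split; last by apply/funext => w; rewrite big_cat.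
  by move=> z; rewrite mem_cat => /orP[/zss|/zss'].
exists [seq (c * z.1, z.2) | z <- zs]; split; first by move=> _ /mapP[z /zss ? ->].
apply/funext => w; rewrite big_map mulr_sumr.
by apply: eq_bigr => z _; rewrite mulrA.
Qed.

Lemma trig_poly_cst (c : R) : trig_poly s (fun=> c).
Proof.
have := @trig_poly_cos c 0 [::] isT.
by under eq_fun do rewrite /lin big_nil addr0 cos0 mulr1.
Qed.

Lemma trig_poly_mul f g : trig_poly s f -> trig_poly s g -> trig_poly s (fun w => f w * g w).
Proof.
move=> [zs [zss ->]] [zs' [zss' ->]].
under eq_fun do rewrite big_distrlr/=.
have [KD KZ] := trig_poly_linear.
apply: class_sum; [exact: trig_poly_linear|exact: trig_poly_cst|move=> z zz].
apply: class_sum; [exact: trig_poly_linear|exact: trig_poly_cst|move=> z' zz'].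
rewrite (_ : (fun w => _) = (fun w =>
  (z.1 * z'.1 / 2) * cos (lin (z.2.2 ++ z'.2.2) w + (z.2.1 + z'.2.1)) +
  (z.1 * z'.1 / 2) * cos (lin (z.2.2 ++ scale (-1) z'.2.2) w + (z.2.1 - z'.2.1)))).
  by apply/KD; apply: trig_poly_cos; rewrite supported_cat ?supported_scale zss//= zss'.
apply/funext => w; rewrite !lin_cat lin_scale mulN1r.
set a := lin z.2.2 w; set b := lin z'.2.2 w.
have -> : a + b + (z.2.1 + z'.2.1) = (a + z.2.1) + (b + z'.2.1) by ring.
have -> : a - b + (z.2.1 - z'.2.1) = (a + z.2.1) + (- (b + z'.2.1)) by ring.
by move: (a + z.2.1) (b + z'.2.1) => p q; rewrite !cosD cosN sinN; field.
Qed.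

Lemma trig_poly_bounded f : trig_poly s f -> bounded_mfun f.
Proof.
move=> [zs [_ ->]]; apply: class_sum.
- by split=> [? ?|? ?]; [exact: bounded_mfunD|exact: bounded_mfunZ].
- exact: bounded_mfun_cst.
- by move=> z _; apply: bounded_mfunZ; exact: bounded_mfun_cos.
Qed.

End trig_poly.

Lemma lin_bounded_integrable x f : supported onT x -> bounded_mfun f ->
  Rintegrable P (fun w => lin x w * f w).
Proof.
move=> xT [mf [M fM]]; apply: (@le_Rintegrable _ _ _ P _ (fun w => M * `|lin x w|)).
- by apply: measurable_funM => //; exact: measurable_lin.
- by move=> w; rewrite normrM mulrC ler_wpM2r.
- by apply: RintegrableZ; apply: integrable_norm; exact: lin_integrable.
Qed.

Lemma trig_poly_orthogonal x (zs : seq (R * (R * seq (R * R)))) : supported onT x ->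
  (forall z, z \in zs -> supported onT z.2.2 /\ Q x z.2.2 = 0) ->
  \int[P]_w (lin x w * \sum_(z <- zs) z.1 * cos (lin z.2.2 w + z.2.1)) = 0.
Proof.
move=> xT; elim: zs => [|z zs IH] zP.
  by under eq_Rintegral do rewrite big_nil mulr0; rewrite Rintegral_cst ?mul0r.
have int f : bounded_mfun f -> Rintegrable P (fun w => lin x w * f w).
  exact: lin_bounded_integrable.
have [zT zo] := zP z (mem_head _ _).
have ? : bounded_mfun (fun w => cos (lin z.2.2 w + z.2.1)) by exact: bounded_mfun_cos.
transitivity (\int[P]_w (z.1 * (lin x w * cos (lin z.2.2 w + z.2.1)) +
    lin x w * \sum_(z <- zs) z.1 * cos (lin z.2.2 w + z.2.1))).
  by apply: eq_Rintegral => w _; rewrite big_cons; ring.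
rewrite RintegralD//; last 2 first.
- by apply: RintegrableZ; exact: int.
- apply: int; apply: (@trig_poly_bounded T).
  by exists zs; split => // y yzs; have [] := zP y; rewrite ?inE ?yzs ?orbT.
rewrite RintegralZl//; last exact: int.
rewrite IH => [|y yzs]; last by apply: zP; rewrite inE yzs orbT.
(* A shift of the phase by [pi / 2] turns the cosine into a sine. *)
have := @lin_sin_orthogonal _ _ (z.2.1 + pi / 2) xT zT zo.
under eq_Rintegral do rewrite addrA sinDpihalf.
by move=> ->; rewrite mulr0 addr0.
Qed.

Hypothesis m2_gt0 : 0 < m2.

(** With [L] the projection of the increment on the linear combinations occurring in [W], the
    residual [xi] is orthogonal to [L] and to [W]. Hence the squared distance to [W] is at least the
    second moment of [xi], which [fbm_quad_ge] bounds since [L] lives on the past. *)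
Lemma trig_poly_dist_ge (s h : R) W : 0 <= s -> 0 <= h -> s + h <= T -> trig_poly s W ->
  m2 * (h `^ (2 * H) / 2) <=
  \int[P]_w ((lin [:: (1, s + h); (-1, s)] w - W w) ^+ 2).
Proof.
move=> s0 h0 shT sW; have bW := trig_poly_bounded sW.
move: sW => [zs [zss WE]]; set x := [:: _ ; _].
have pastT v : supported (past s) v -> supported onT v.
  by apply: sub_all => p /andP[p0 ps]; rewrite /onT p0 (le_trans ps)// (le_trans _ shT)// lerDl.
have xT : supported onT x.
  by rewrite /supported/= /onT shT addr_ge0// s0 (le_trans _ shT)// lerDl.
have [|L [sL spL oL]] := @quad_projection _ _ onT (@fbm_covC _ H) Q_ge0
   [seq z.2.2 | z <- zs] x _ xT; first by move=> v /mapP[z /zss/pastT ? ->].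
have Ls : supported (past s) L by apply: sL => v /mapP[z /zss ? ->].
have LT := pastT _ Ls; pose xi := x ++ scale (-1) L.
have xiT : supported onT xi by rewrite supported_cat supported_scale xT.
have xiL : Q xi L = 0 by exact: spL.
have xiW : \int[P]_w (lin xi w * W w) = 0.
  rewrite WE; apply: trig_poly_orthogonal => // z zz; split; first exact/pastT/zss.
  by apply: oL; apply/mapP; exists z.
have ixiW : Rintegrable P (fun w => lin xi w * W w) by exact: lin_bounded_integrable.
have ixiL : Rintegrable P (fun w => lin xi w * lin L w) by exact: lin_mul_integrable.
have ixi : Rintegrable P (fun w => lin xi w ^+ 2) by exact: lin_sqr_integrable.
apply: (@le_trans _ _ (m2 * Q xi xi)).
  rewrite ler_pM2l// /xi /x /=.
  apply: fbm_quad_ge => //=; rewrite s0 lexx/=.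
  by have := Ls; rewrite -(supported_scale _ (-1)).
(* The two added terms have mean zero; with them the integrand falls short of the square of the
   increment minus [W] exactly by the square of [L - W]. *)
have -> : m2 * Q xi xi = \int[P]_w (lin xi w ^+ 2 +
    (2 * (lin xi w * lin L w) - 2 * (lin xi w * W w))).
  rewrite RintegralD//; last by apply: RintegrableB; exact: RintegrableZ.
  rewrite RintegralB//; [|exact: RintegrableZ..].
  by rewrite !RintegralZl// Rintegral_lin_sqr// Rintegral_lin_mul// xiL xiW !mulr0 subrr addr0.
apply: le_Rintegral => //.
- by apply: RintegrableD => //; apply: RintegrableB; exact: RintegrableZ.
- apply: (@le_Rintegrable _ _ _ P _ (fun w => 2 * lin x w ^+ 2 + 2 * W w ^+ 2)).
  + apply: measurable_funX; apply: measurable_funB; [exact: measurable_lin|by case: bW].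
  + by move=> w; rewrite ger0_norm ?sqr_ge0//; have := sqr_ge0 (lin x w + W w); lra.
  + apply: RintegrableD; apply: RintegrableZ; first exact: lin_sqr_integrable.
    by apply: bounded_mfun_integrable; exact: bounded_mfunX.
- move=> w _; rewrite /xi lin_cat lin_scale mulN1r.
  have := sqr_ge0 (lin L w - W w); lra.
Qed.

(** * From trigonometric polynomials to the natural filtration *)

Notation cl s := (L2_closure P (trig_poly s)).

(** The indicator is half of sg + sg^2 for the sign of [B u - a]. That sign is the limit of the
    signs of sines of ever smaller multiples of [B u - a], which eventually fall within half a
    period. *)
Lemma L2_closure_ray (s u a : R) : past s u -> cl s (\1_(B u @^-1` `]a, +oo[)).
Proof.
move=> us.
have KM := L2_closureM (@trig_poly_bounded s) (@trig_poly_mul s).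
have KD := L2_closureD (@trig_poly_bounded s) (trig_poly_linear s).
have KZ := L2_closureZ (@trig_poly_bounded s) (trig_poly_linear s) (@trig_poly_mul s)
  (@trig_poly_cst s 1).
have Ksg : cl s (fun w => Num.sg (B u w - a)).
  apply: (@L2_closure_lim _ _ _ P (trig_poly s) (@trig_poly_bounded s)
     (fun n w => Num.sg (sin (n.+1%:R^-1 * (B u w - a)))) _ 1).
  - move=> n; apply: L2_closure_sgn.
    + exact: trig_poly_bounded.
    + exact: trig_poly_linear.
    + exact: trig_poly_mul.
    + exact: trig_poly_cst.
    + by move=> w; exact: sin_max.
    apply: L2_closure_sub; first exact: trig_poly_bounded.
    have := @trig_poly_cos s 1 (- (n.+1%:R^-1 * a) - pi / 2) [:: (n.+1%:R^-1, u)].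
    rewrite /supported/= us => /(_ isT).
    under eq_fun do rewrite /lin big_seq1 mul1r addrA -mulrBr -cosN opprB addrC cosDpihalf sinN opprK.
    done.
  - move=> n w; rewrite normr_sg; by case: (_ != _).
  - move=> w; move: (B u w - a) => y; apply: cvg_near_cst.
    have W z : 0 < z -> \forall n \near \oo, 0 < sin (n.+1%:R^-1 * z).
      move=> z0; near=> n; apply: sin_gt0_pi; rewrite mulr_gt0 ?invr_gt0//=.
      rewrite -ltr_pdivlMr//; near: n.
      have pz : 0 < pi / z by rewrite divr_gt0// pi_gt0.
      exact: (near_infty_natSinv_lt (PosNum pz)).
    have [y0|y0|<-] := ltgtP 0 y.
    + near=> n; rewrite (gtr0_sg y0) gtr0_sg//; near: n; exact: W.
    + near=> n; rewrite (ltr0_sg y0) ltr0_sg// -oppr_gt0 -sinN -mulrN; near: n.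
      by apply: W; rewrite oppr_gt0.
    + by apply: nearW => n; rewrite mulr0 sin0.
rewrite (_ : \1_ _ = fun w => 2^-1 * (Num.sg (B u w - a) +
    Num.sg (B u w - a) * Num.sg (B u w - a))).
  by apply/KZ/KD => //; exact: KM.
apply/funext => w; rewrite indicE.
have [y0|y0] := ltP a (B u w).
  rewrite mem_set/=; last by rewrite in_itv/= andbT.
  by rewrite gtr0_sg ?subr_gt0//; field.
rewrite memNset/=; last by rewrite in_itv/= andbT ltNge y0.
move: y0; rewrite -subr_le0 le_eqVlt => /predU1P[->|y0].
  by rewrite sgr0; ring.
by rewrite ltr0_sg//; ring.
Unshelve. all: by end_near. Qed.

(** The events with indicator in the closure form a sigma-algebra; it contains the preimages of
    rays, and rays generate the Borel sets. *)
Lemma L2_closure_filtration (s : R) S : natural_filtration B s S -> cl s (\1_S).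
Proof.
have sig : sigma_algebra setT [set S | cl s (\1_S)].
  apply: L2_closure_sigma_algebra.
  - exact: trig_poly_bounded.
  - exact: trig_poly_linear.
  - exact: trig_poly_mul.
  - exact: trig_poly_cst.
move: S; apply: smallest_sub => // S [u us] [A mA <-] /=.
have mA' : (@measurable _ (measurableTypeR R)) A by exact: mA.
rewrite RGenOInfty.measurableE in mA'.
move: A mA' {mA}; apply: smallest_sub; first exact: (sigma_algebra_image (B u) sig).
move=> _ [a ->]; rewrite /image_set_system/= setTI; apply: L2_closure_ray.
by move: us; rewrite /= in_itv.
Qed.

Lemma filtration_dist_ge (s h : R) (Z : Omega -> R) : 0 <= s -> 0 <= h -> s + h <= T ->
  (forall A : set R, measurable A -> natural_filtration B s (Z @^-1` A)) ->
  (exists M : R, forall w, `|Z w| <= M) ->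
  bounded_mfun Z /\
  m2 * (h `^ (2 * H) / 2) <= \int[P]_w ((B (s + h) w - B s w - Z w) ^+ 2).
Proof.
move=> s0 h0 shT Zs bZ.
have clZ : cl s Z.
  apply: (@bounded_limit_closed_mfun _ _ _ (cl s) (natural_filtration B s)) => //.
  - apply: L2_closure_linear.
    + exact: trig_poly_bounded.
    + exact: trig_poly_linear.
    + exact: trig_poly_mul.
    + exact: trig_poly_cst.
  - by apply: L2_closure_lim; exact: trig_poly_bounded.
  - exact: L2_closure_filtration.
split; first by case: clZ.
have linE w : lin [:: (1, s + h); (-1, s)] w = B (s + h) w - B s w.
  by rewrite /lin !big_cons big_nil mul1r mulN1r addr0.
under eq_Rintegral do rewrite -linE.
apply: (@L2_closure_dist_ge _ _ _ P (trig_poly s) (@trig_poly_bounded s)) clZ.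
- exact: measurable_lin.
- apply: lin_sqr_integrable; rewrite /supported/= /onT shT addr_ge0//.
  by rewrite s0 (le_trans _ shT)// lerDl.
- by move=> W; exact: trig_poly_dist_ge.
Qed.

Lemma Rintegral_increment_sqr (s t : R) : 0 <= s -> s <= t -> t <= T ->
  Rintegrable P (fun w => (B t w - B s w) ^+ 2) /\
  \int[P]_w ((B t w - B s w) ^+ 2) = m2 * (t - s) `^ (2 * H).
Proof.
move=> s0 st tT.
have linE w : lin [:: (1, t); (-1, s)] w = B t w - B s w.
  by rewrite /lin !big_cons big_nil mul1r mulN1r addr0.
have xT : supported onT [:: (1, t); (-1, s)].
  by rewrite /supported/= /onT tT (le_trans s0 st) s0 (le_trans st tT).
rewrite -(funext (fun w => congr1 (fun u => u ^+ 2) (linE w))).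
split; first exact: lin_sqr_integrable.
rewrite Rintegral_lin_sqr//; congr (_ * _).
have a0 : 2 * H != 0 by rewrite gt_eqF// mulr_gt0.
rewrite /quad !big_cons !big_nil /fbm_cov /= !subrr normr0 powR0// (distrC s t).
by rewrite (ger0_norm (x := t - s)) ?subr_ge0//; field.
Qed.

End gaussian.

(** * Conditional expectations *)

Section truncation.
Context {R : realType}.

(** Large values are sent to 0 rather than clipped to the bound, which yields the exact identity
    [mul_truncate]. *)
Definition truncate (N : nat) (y : R) : R := y * \1_[set z : R | `|z| <= N%:R] y.

Lemma measurable_truncate N : measurable_fun setT (truncate N).
Proof.
apply: measurable_funM => //; apply: measurable_indic.
rewrite (_ : [set _ | _] = `[- N%:R, N%:R]%classic); first exact: measurable_itv.
by apply/seteqP; split=> z /=; rewrite in_itv/= ler_norml.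
Qed.

Lemma truncateE N y : truncate N y = if `|y| <= N%:R then y else 0.
Proof.
rewrite /truncate indicE; case: ifPn => yN; first by rewrite mem_set ?mulr1.
by rewrite memNset ?mulr0//; exact/negP.
Qed.

Lemma truncate_bound N y : `|truncate N y| <= N%:R.
Proof. by rewrite truncateE; case: ifPn => // _; rewrite normr0. Qed.

Lemma truncate_norm_le N y : `|truncate N y| <= `|y|.
Proof. by rewrite truncateE; case: ifPn => // _; rewrite normr0. Qed.

Lemma mul_truncate N y : y * truncate N y = truncate N y ^+ 2.
Proof. by rewrite truncateE; case: ifPn => _; rewrite ?expr2 ?mulr0. Qed.

Lemma cvg_truncate y : truncate N y @[N --> \oo] --> y.
Proof.
apply: cvg_near_cst; near=> N; rewrite truncateE ifT//; near: N.
exact: nbhs_infty_ger.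
Unshelve. all: by end_near. Qed.

Lemma truncate_sqr_homo y : {homo (fun N => truncate N y ^+ 2) : m n / (m <= n)%N >-> m <= n}.
Proof.
move=> m n mn; rewrite !truncateE; case: ifPn => ym.
  by rewrite ifT// (le_trans ym)// ler_nat.
by rewrite expr0n sqr_ge0.
Qed.

End truncation.

Section conditional_expectation.
Context d (Omega : measurableType d) (R : realType) (P : probability Omega R).
Variables (F : set (set Omega)) (X Y : Omega -> R).
Notation G := <<s F>>.
Hypothesis GM : forall A, G A -> measurable A.
Hypothesis iX : Rintegrable P X.
Hypothesis XY : is_cond_exp P G X Y.

Let iY : Rintegrable P Y. Proof. by case: XY. Qed.

Lemma bounded_mfun_G (Z : Omega -> R) :
  (forall A : set R, measurable A -> G (Z @^-1` A)) ->
  (exists M : R, forall w, `|Z w| <= M) -> bounded_mfun Z.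
Proof. by move=> GZ bZ; split => // _ A mA; rewrite setTI; apply: GM; exact: GZ. Qed.

Let int_bounded (f Z : Omega -> R) : Rintegrable P f -> bounded_mfun Z ->
  Rintegrable P (fun w => f w * Z w).
Proof.
move=> fi [mZ [M ZM]]; apply: (@le_Rintegrable _ _ _ P _ (fun w => M * `|f w|)).
- by apply: measurable_funM => //; exact: Rintegrable_measurable fi.
- by move=> w; rewrite normrM mulrC ler_wpM2r.
- by apply: RintegrableZ; exact: integrable_norm.
Qed.

(** The bounded functions orthogonal to [X - Y] form a linear class closed under bounded limits, and
    the defining property of [Y] puts the indicators of [G] in it. *)
Lemma cond_exp_orthogonal_bounded (Z : Omega -> R) :
  (forall A : set R, measurable A -> G (Z @^-1` A)) ->
  (exists M : R, forall w, `|Z w| <= M) ->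
  \int[P]_w ((X w - Y w) * Z w) = 0.
Proof.
move=> GZ bZ; have [_ _ cY] := XY.
have iXY : Rintegrable P (fun w => X w - Y w) by exact: RintegrableB.
pose K : set (Omega -> R) := [set f | bounded_mfun f /\ \int[P]_w ((X w - Y w) * f w) = 0].
suff [] : K Z by [].
apply: (@bounded_limit_closed_mfun _ _ _ K G) => //.
- split=> [f g [bf f0] [bg g0]|c f [bf f0]]; split.
  + exact: bounded_mfunD.
  + under eq_Rintegral do rewrite mulrDr.
    by rewrite RintegralD ?f0 ?g0 ?addr0//; exact: int_bounded.
  + exact: bounded_mfunZ.
  + under eq_Rintegral do rewrite mulrCA.
    by rewrite RintegralZl ?f0 ?mulr0//; exact: int_bounded.
- move=> f_ f M Kf f_M ff.
  have mf_ n : measurable_fun setT (f_ n) by case: (Kf n) => -[].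
  have [mf fM] := bounded_mfun_lim mf_ f_M ff.
  split; first by split => //; exists M.
  have mXY := Rintegrable_measurable iXY.
  have : \int[P]_w ((X w - Y w) * f_ n w) @[n --> \oo] --> \int[P]_w ((X w - Y w) * f w).
    apply: (@Rintegral_cvg _ _ _ P _ _ (fun w => M * `|X w - Y w|)).
    + by move=> n; exact: measurable_funM.
    + exact: measurable_funM.
    + by move=> w; apply: cvgM; [exact: cvg_cst|exact: ff].
    + by apply: RintegrableZ; exact: integrable_norm.
    + by move=> n w; rewrite normrM mulrC ler_wpM2r.
  rewrite (_ : (fun n => _) = fun=> 0); last by apply/funext => n; case: (Kf n).
  by move/cvg_lim => <-//; rewrite lim_cst.
- move=> A GA; have mA := GM GA; split.
    by split => //; exists 1 => w; rewrite indicE; case: (_ \in _); rewrite ?normr0 ?normr1.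
  have indE (f : Omega -> R) : \int[P]_w (f w * \1_A w) = \int[P]_(w in A) f w.
    rewrite [RHS]Rintegral_mkcond; apply: eq_Rintegral => w _.
    by rewrite patchE indicE; case: ifP => _; rewrite ?mulr1 ?mulr0.
  rewrite indE RintegralB//; last 2 first.
  + by apply: (integrableS measurableT).
  + by apply: (integrableS measurableT).
  by rewrite /Rintegral (cY _ GA) subrr.
Qed.

Hypothesis iX2 : Rintegrable P (fun w => X w ^+ 2).

(** Square integrability of [Y] is part of the conclusion, so truncations [Y_ N] are used as
    competitors: orthogonality gives E (X Y_N) = E Y_N^2, so c <= E X^2 - E Y_N^2, and monotone
    convergence concludes. *)
Lemma cond_exp_sqr_le (c : R) :
  (forall Z : Omega -> R, (forall A : set R, measurable A -> G (Z @^-1` A)) ->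
    (exists M : R, forall w, `|Z w| <= M) -> c <= \int[P]_w ((X w - Z w) ^+ 2)) ->
  Rintegrable P (fun w => Y w ^+ 2) /\
  \int[P]_w (Y w ^+ 2) <= \int[P]_w (X w ^+ 2) - c.
Proof.
move=> cZ; have [GY _ _] := XY.
pose Y_ N w := truncate N (Y w).
have GY_ N (A : set R) : measurable A -> G (Y_ N @^-1` A).
  move=> mA; rewrite -[_ @^-1` _]/(Y @^-1` (truncate N @^-1` A)); apply: GY.
  by rewrite -[_ @^-1` _]setTI; exact: measurable_truncate.
have bY_ N : exists M : R, forall w, `|Y_ N w| <= M.
  by exists N%:R => w; exact: truncate_bound.
have bmY_ N : bounded_mfun (Y_ N) by exact: (bounded_mfun_G (GY_ N) (bY_ N)).
have iY_ N : Rintegrable P (fun w => Y_ N w ^+ 2).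
  by apply: bounded_mfun_integrable; exact: bounded_mfunX.
have Yle N : \int[P]_w (Y_ N w ^+ 2) <= \int[P]_w (X w ^+ 2) - c.
  have XYN : \int[P]_w (X w * Y_ N w) = \int[P]_w (Y_ N w ^+ 2).
    have := cond_exp_orthogonal_bounded (@GY_ N) (bY_ N).
    under eq_Rintegral do rewrite mulrBl mul_truncate.
    rewrite RintegralB//; [|exact: int_bounded|exact: iY_].
    by move/eqP; rewrite subr_eq0 => /eqP.
  have iXY_ : Rintegrable P (fun w => X w * Y_ N w) by exact: int_bounded.
  have := cZ _ (@GY_ N) (bY_ N).
  have -> : \int[P]_w ((X w - Y_ N w) ^+ 2) =
      \int[P]_w (X w ^+ 2 + (Y_ N w ^+ 2 - 2 * (X w * Y_ N w))).
    by apply: eq_Rintegral => w _; ring.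
  rewrite RintegralD//; last by apply: RintegrableB; [exact: iY_|exact: RintegrableZ].
  rewrite RintegralB//; [|exact: iY_|exact: RintegrableZ].
  by rewrite RintegralZl// XYN; lra.
have mY := Rintegrable_measurable iY.
have lim : (\int[P]_w (Y w ^+ 2)%:E <= (\int[P]_w (X w ^+ 2) - c)%:E)%E.
  have YE w : (fun N => (Y_ N w ^+ 2)%:E) @ \oo --> (Y w ^+ 2)%:E.
    apply: cvg_EFin; first exact: nearW.
    have h := @cvgM _ _ \oo _ _ _ _ _ (@cvg_truncate R (Y w)) (@cvg_truncate R (Y w)).
    exact: h.
  have m_ N : measurable_fun setT (fun w => (Y_ N w ^+ 2)%:E).
    by apply/measurable_EFinP; exact: Rintegrable_measurable (iY_ N).
  have ge0_ N w : setT w -> (0 <= (Y_ N w ^+ 2)%:E)%E by rewrite lee_fin sqr_ge0.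
  have nd_ w : setT w -> {homo (fun N => (Y_ N w ^+ 2)%:E) : m n / (m <= n)%N >-> (m <= n)%E}.
    by move=> _ m n mn; rewrite lee_fin; exact: truncate_sqr_homo.
  have cvgY := cvg_monotone_convergence (mu := P) measurableT m_ ge0_ nd_.
  rewrite -(_ : (\int[P]_w lim ((Y_ N w ^+ 2)%:E @[N --> \oo])) =
    \int[P]_w (Y w ^+ 2)%:E)%E; last first.
    by apply: eq_integral => w _; apply/cvg_lim => //; exact: YE.
  rewrite -(cvg_lim _ cvgY)//; apply: lime_le; first by apply/cvg_ex; eexists; exact: cvgY.
  apply: nearW => N; rewrite -[leLHS]fineK ?lee_fin; first exact: Yle.
  exact: (integrable_fin_num measurableT (iY_ N)).
have iY2 : Rintegrable P (fun w => Y w ^+ 2).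
  apply/integrableP; split; first by apply/measurable_EFinP; exact: measurable_funX.
  under eq_integral do rewrite gee0_abs ?lee_fin ?sqr_ge0//.
  by rewrite (le_lt_trans lim)// ltry.
split=> //; rewrite -lee_fin; apply: le_trans lim.
by rewrite /Rintegral fineK//; exact: integrable_fin_num.
Qed.

Hypothesis iY2 : Rintegrable P (fun w => Y w ^+ 2).

Lemma cond_exp_orthogonal (Z : Omega -> R) :
  (forall A : set R, measurable A -> G (Z @^-1` A)) ->
  Rintegrable P (fun w => Z w ^+ 2) ->
  \int[P]_w ((X w - Y w) * Z w) = 0.
Proof.
move=> GZ iZ2.
pose Z_ N w := truncate N (Z w).
have GZ_ N (A : set R) : measurable A -> G (Z_ N @^-1` A).
  move=> mA; rewrite -[_ @^-1` _]/(Z @^-1` (truncate N @^-1` A)); apply: GZ.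
  by rewrite -[_ @^-1` _]setTI; exact: measurable_truncate.
have bZ_ N : exists M : R, forall w, `|Z_ N w| <= M.
  by exists N%:R => w; exact: truncate_bound.
have mZ : measurable_fun setT Z.
  by move=> _ A mA; rewrite setTI; apply: GM; exact: GZ.
have mXY : measurable_fun setT (fun w => X w - Y w).
  by apply: measurable_funB; [exact: Rintegrable_measurable iX|exact: Rintegrable_measurable iY].
have : \int[P]_w ((X w - Y w) * Z_ n w) @[n --> \oo] --> \int[P]_w ((X w - Y w) * Z w).
  apply: (@Rintegral_cvg _ _ _ P _ _ (fun w => 2 * X w ^+ 2 + 2 * Y w ^+ 2 + Z w ^+ 2)).
  - by move=> n; apply: measurable_funM => //; case: (bounded_mfun_G (@GZ_ n) (bZ_ n)).
  - exact: measurable_funM.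
  - by move=> w; apply: cvgM; [exact: cvg_cst|exact: cvg_truncate].
  - by apply: RintegrableD => //; apply: RintegrableD; exact: RintegrableZ.
  - move=> n w; rewrite normrM (@le_trans _ _ (`|X w - Y w| * `|Z w|))//.
      by rewrite ler_wpM2l// truncate_norm_le.
    have h := sqr_ge0 (`|X w - Y w| - `|Z w|).
    rewrite (sqrrB `|X w - Y w|) !real_normK ?num_real// in h.
    have := sqr_ge0 (X w + Y w); have := sqr_ge0 (X w - Y w); have := sqr_ge0 (Z w); lra.
rewrite (_ : (fun n => _) = fun=> 0); last first.
  by apply/funext => n; exact: (cond_exp_orthogonal_bounded (@GZ_ n) (bZ_ n)).
by move/cvg_lim => <-//; rewrite lim_cst.
Qed.

End conditional_expectation.

(** * The compensator along a partition *)

Section square_integrable.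
Context d (Omega : measurableType d) (R : realType) (P : probability Omega R).
Implicit Types f g : Omega -> R.

Definition square_integrable f :=
  measurable_fun setT f /\ Rintegrable P (fun w => f w ^+ 2).

Lemma square_integrableM f g : square_integrable f -> square_integrable g ->
  Rintegrable P (fun w => f w * g w).
Proof.
move=> [mf i_f] [mg ig].
apply: (@le_Rintegrable _ _ _ P _ (fun w => f w ^+ 2 + g w ^+ 2)).
- exact: measurable_funM.
- move=> w; have h := sqr_ge0 (`|f w| - `|g w|).
  rewrite (sqrrB `|f w|) !real_normK ?num_real// in h.
  by rewrite normrM; have := sqr_ge0 (f w); have := sqr_ge0 (g w); lra.
- exact: RintegrableD.
Qed.

Lemma square_integrableB f g : square_integrable f -> square_integrable g ->
  square_integrable (fun w => f w - g w).
Proof.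
move=> [mf i_f] [mg ig]; have mfg := measurable_funB mf mg; split => //.
apply: (@le_Rintegrable _ _ _ P _ (fun w => 2 * f w ^+ 2 + 2 * g w ^+ 2)).
- exact: measurable_funX.
- by move=> w; rewrite ger0_norm ?sqr_ge0//; have := sqr_ge0 (f w + g w); lra.
- by apply: RintegrableD; exact: RintegrableZ.
Qed.

Lemma square_integrable_sum n (f : 'I_n -> Omega -> R) :
  (forall k, square_integrable (f k)) -> square_integrable (fun w => \sum_(k < n) f k w).
Proof.
move=> fk; split; first by apply: measurable_sum => k; case: (fk k).
under eq_fun do rewrite expr2 big_distrlr/=.
apply: Rintegrable_sum => j; apply: Rintegrable_sum => k; exact: square_integrableM.
Qed.

Lemma Rintegral_sqr_sum_orthogonal n (f : 'I_n -> Omega -> R) :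
  (forall k, square_integrable (f k)) ->
  (forall j k : 'I_n, (j < k)%N -> \int[P]_w (f k w * f j w) = 0) ->
  \int[P]_w ((\sum_(k < n) f k w) ^+ 2) = \sum_(k < n) \int[P]_w (f k w ^+ 2).
Proof.
move=> fk orth; under eq_Rintegral do rewrite expr2 big_distrlr/=.
rewrite Rintegral_sum => [|j]; last by apply: Rintegrable_sum => k; exact: square_integrableM.
apply: eq_bigr => j _; rewrite Rintegral_sum => [|k]; last exact: square_integrableM.
rewrite (bigD1 j)//= big1 ?addr0// => k kj.
have [jk|jk|/val_inj jk] := ltngtP (val j) (val k).
- by rewrite -[RHS](orth _ _ jk); apply: eq_Rintegral => w _; rewrite mulrC.
- exact: orth.
- by rewrite jk eqxx in kj.
Qed.

End square_integrable.

(** * Measurability with respect to the natural filtration *)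

Section filtration.
Context d (Omega : measurableType d) (R : realType).
Variable B : R -> Omega -> R.
Hypothesis mB : forall t, measurable_fun setT (B t).

Definition adapted (t : R) (f : Omega -> R) :=
  forall A : set R, measurable A -> natural_filtration B t (f @^-1` A).

Lemma natural_filtration_measurable t A : natural_filtration B t A -> measurable A.
Proof.
move: A; apply: smallest_sub; first exact: sigma_algebra_measurable.
by move=> A [u _] [C mC <-]; exact: mB.
Qed.

Lemma adapted_le s t f : s <= t -> adapted s f -> adapted t f.
Proof.
move=> st fs A mA; have := fs A mA; apply: sub_smallest2r.
  exact: smallest_sigma_algebra.
apply: bigcup_subset => u; rewrite /= !in_itv/= => /andP[-> us].
exact: le_trans us st.
Qed.

Lemma adapted_process u t : 0 <= u <= t -> adapted t (B u).
Proof.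
move=> ut A mA; apply: sub_gen_smallest; exists u; first by rewrite /= in_itv.
by exists A => //; rewrite setTI.
Qed.

Lemma adaptedB t f g : adapted t f -> adapted t g -> adapted t (fun w => f w - g w).
Proof.
move=> af ag A mA.
pose S := g_sigma_algebraType
  (\bigcup_(u in `[0, t]) preimage_set_system setT (B u) (@measurable _ R)).
have mf : measurable_fun [set: S] (f : S -> R) by move=> _ C mC; rewrite setTI; exact: af.
have mg : measurable_fun [set: S] (g : S -> R) by move=> _ C mC; rewrite setTI; exact: ag.
by have := measurable_funB mf mg measurableT mA; rewrite setTI.
Qed.

End filtration.

(** * Partitions of the time interval *)

Section partition.
Context {R : realType}.
Implicit Types (T a : R) (s : seq R).

Lemma partition_incr T s k : is_partition T s -> (k < (size s).-1)%N -> s`_k < s`_k.+1.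
Proof. by move=> [/(sortedP 0) h _ _ _] ks; apply: h; rewrite -ltn_predRL. Qed.

Lemma partition_le T s j k : is_partition T s -> (j <= k)%N -> (k <= (size s).-1)%N ->
  s`_j <= s`_k.
Proof.
move=> ps; elim: k => [|k IH]; first by rewrite leqn0 => /eqP ->.
rewrite leq_eqVlt => /predU1P[->//|jk] ks.
by rewrite (le_trans (IH _ (ltnW ks)))// ltW// (partition_incr ps).
Qed.

Lemma partition_first T s : is_partition T s -> s`_0 = 0.
Proof. by move=> [_ _ s0 _]; rewrite nth0. Qed.

Lemma partition_last T s : is_partition T s -> s`_(size s).-1 = T.
Proof. by move=> [_ sn _ <-]; rewrite nth_last; case: s sn. Qed.

Lemma mesh_ge s k : (k < (size s).-1)%N -> s`_k.+1 - s`_k <= mesh s.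
Proof. by move=> ks; rewrite /mesh (le_bigmax _ _ (Ordinal ks)). Qed.

(** Each power is the cell length times its power [a - 1], and this negative exponent makes the
    second factor at least that of [e]; the lengths telescope to [T]. *)
Lemma sum_powR_ge T s a (e : R) : 0 < T -> 0 < a < 1 -> is_partition T s ->
  0 < e -> mesh s <= e ->
  T * e `^ (a - 1) <= \sum_(k < (size s).-1) (s`_k.+1 - s`_k) `^ a.
Proof.
move=> T0 /andP[a0 a1] ps e0 se.
have -> : T = \sum_(k < (size s).-1) (s`_k.+1 - s`_k).
  rewrite -(big_mkord xpredT (fun k => s`_k.+1 - s`_k)) telescope_sumr//.
  by rewrite (partition_last ps) (partition_first ps) subr0.
rewrite mulr_suml; apply: ler_sum => k _.
have h0 : 0 < s`_k.+1 - s`_k by rewrite subr_gt0 (partition_incr ps).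
rewrite -(mulr_powRB1 (ltW h0) a0) ler_pM2l//.
rewrite -(opprB 1 a) !powRN lef_pV2 ?posrE ?powR_gt0//.
rewrite ge0_ler_powR ?nnegrE ?(ltW h0) ?(ltW e0)//; first by rewrite subr_ge0 ltW.
by rewrite (le_trans _ se)// mesh_ge.
Qed.

End partition.

(** * Second moment of the compensator on one partition *)

Section compensator.
Context d (Omega : measurableType d) (R : realType) (P : probability Omega R).
Variables (H T : R) (B : R -> Omega -> R) (s : seq R) (Y : nat -> Omega -> R).
Hypothesis H0 : 0 < H.
Hypothesis H1 : H < 1 / 2.
Hypothesis T0 : 0 < T.
Hypothesis fBm : is_fBm P H T B.
Hypothesis ps : is_partition T s.
Let n := (size s).-1.
Hypothesis YP : forall k, (k < n)%N -> is_cond_exp P (natural_filtration B s`_k)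
  (fun w => B s`_k.+1 w - B s`_k w) (Y k).
Variable m2 : R.
Hypothesis m2E : (\int[normal_prob 0 (1 : R)]_x (x ^+ 2)%:E = m2%:E)%E.
Hypothesis m2_gt0 : 0 < m2.

Let mB : forall t, measurable_fun setT (B t). Proof. by case: fBm. Qed.
Let X k w := B s`_k.+1 w - B s`_k w.
Let h k := s`_k.+1 - s`_k.

Let s_ge0 k : (k <= n)%N -> 0 <= s`_k.
Proof. by move=> kn; have := partition_le ps (leq0n k) kn; rewrite (partition_first ps). Qed.

Let s_le k : (k <= n)%N -> s`_k <= T.
Proof. by move=> kn; have := partition_le ps kn (leqnn _); rewrite (partition_last ps). Qed.

Let square_integrable_incr u t : 0 <= u -> u <= t -> t <= T ->
  square_integrable P (fun w => B t w - B u w).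
Proof.
move=> u0 ut tT; split; first exact: measurable_funB.
by have [] := Rintegral_increment_sqr H0 H1 T0 fBm m2E u0 ut tT.
Qed.

Let X2 k : (k < n)%N -> square_integrable P (X k).
Proof.
move=> kn; apply: square_integrable_incr; [exact/s_ge0/ltnW| |exact: s_le].
exact/ltW/(partition_incr ps).
Qed.

Let Rintegrable_of_square f : square_integrable P f -> Rintegrable P f.
Proof.
move=> [mf f2]; apply: (@le_Rintegrable _ _ _ P _ (fun w => 1 + f w ^+ 2)) => //.
  move=> w; rewrite -(real_normK (num_real (f w))).
  by have := sqr_ge0 (`|f w| - 1); have := normr_ge0 (f w); nra.
by apply: RintegrableD => //; exact: Rintegrable_cst.
Qed.

Lemma compensator_increment_bound k : (k < n)%N -> square_integrable P (Y k) /\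
  \int[P]_w (Y k w ^+ 2) <= \int[P]_w (X k w ^+ 2) - m2 * (h k `^ (2 * H) / 2).
Proof.
move=> kn; have hk0 : 0 <= h k by rewrite /h subr_ge0 ltW// (partition_incr ps).
have iX : Rintegrable P (X k) by exact/Rintegrable_of_square/X2.
have iX2 : Rintegrable P (fun w => X k w ^+ 2) by case: (X2 kn).
have dist (Z : Omega -> R) : adapted B s`_k Z -> (exists M : R, forall w, `|Z w| <= M) ->
    m2 * (h k `^ (2 * H) / 2) <= \int[P]_w ((X k w - Z w) ^+ 2).
  move=> GZ bZ; have skh : s`_k + h k = s`_k.+1 by rewrite /h addrC subrK.
  have skT : s`_k + h k <= T by rewrite skh; exact: s_le.
  have [_] := filtration_dist_ge H0 H1 T0 fBm m2E m2_gt0 (s_ge0 (ltnW kn)) hk0 skT GZ bZ.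
  by rewrite skh.
have [Y2 Yle] := cond_exp_sqr_le (natural_filtration_measurable mB (t := s`_k)) iX (YP kn) iX2 dist.
split=> //; split=> //; have [_ iY _] := YP kn; exact: Rintegrable_measurable iY.
Qed.

Let D k w := X k w - Y k w.

Let D2 k : (k < n)%N -> square_integrable P (D k).
Proof.
by move=> kn; apply: square_integrableB; [exact: X2|case: (compensator_increment_bound kn)].
Qed.

Let D_orthogonal k (Z : Omega -> R) : (k < n)%N -> adapted B s`_k Z ->
  square_integrable P Z -> \int[P]_w (D k w * Z w) = 0.
Proof.
move=> kn GZ [_ iZ2]; have [[_ iY2] _] := compensator_increment_bound kn.
apply: (cond_exp_orthogonal (natural_filtration_measurable mB (t := s`_k)) _ (YP kn) _ iY2 GZ iZ2).
- exact/Rintegrable_of_square/X2.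
- by case: (X2 kn).
Qed.

Let Y_adapted k : (k < n)%N -> adapted B s`_k (Y k).
Proof. by move=> /YP[GY _ _]. Qed.

(** [Y k] may be unbounded, so [filtration_dist_ge] does not apply to it directly; the bound on its
    second moment is converted by Pythagoras, [D k] being orthogonal to [Y k]. *)
Let D_sqr_ge k : (k < n)%N -> m2 * (h k `^ (2 * H) / 2) <= \int[P]_w (D k w ^+ 2).
Proof.
move=> kn; have [Y2 Yle] := compensator_increment_bound kn.
have DY := D_orthogonal kn (Y_adapted kn) Y2.
have iDY : Rintegrable P (fun w => D k w * Y k w).
  by apply: square_integrableM => //; exact: D2.
have [[_ iX2] [_ iY2]] := (X2 kn, Y2).
have -> : \int[P]_w (D k w ^+ 2) =
    \int[P]_w (X k w ^+ 2 - (Y k w ^+ 2 + 2 * (D k w * Y k w))).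
  by apply: eq_Rintegral => w _; rewrite /D; ring.
rewrite RintegralB//; last by apply: RintegrableD => //; exact: RintegrableZ.
rewrite RintegralD//; last exact: RintegrableZ.
by rewrite RintegralZl// DY mulr0 addr0; lra.
Qed.

Let D_adapted j k : (j < k)%N -> (k < n)%N -> adapted B s`_k (D j).
Proof.
move=> jk kn; have jn := ltn_trans jk kn.
have sj : s`_j <= s`_k by apply: (partition_le ps); exact: ltnW.
apply: adaptedB; last exact: adapted_le sj (Y_adapted jn).
apply: adaptedB; apply: adapted_process.
  by rewrite s_ge0//=; apply: (partition_le ps) => //; exact: ltnW.
by rewrite (s_ge0 (ltnW jn)).
Qed.

(** The martingale part [M] is [B T - B 0 - A] by telescoping, so its second moment is at most twice
    that of [B T - B 0] plus twice that of [A]; orthogonality of the [D k] bounds it from below. *)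
Lemma compensator_sqr_ge :
  ((m2 * ((\sum_(k < n) h k `^ (2 * H)) / 4 - T `^ (2 * H)))%:E <=
   \int[P]_w ((\sum_(k < n) Y k w) ^+ 2)%:E)%E.
Proof.
pose A w := \sum_(k < n) Y k w; pose M w := \sum_(k < n) D k w.
have A2 : square_integrable P A.
  by apply: square_integrable_sum => k; case: (compensator_increment_bound (ltn_ord k)).
have BT2 : square_integrable P (fun w => B T w - B 0 w).
  by apply: square_integrable_incr => //; exact: ltW.
have MA w : M w = B T w - B 0 w - A w.
  rewrite /M /D sumrB; congr (_ - _).
  rewrite -(big_mkord xpredT (fun k => X k w)) telescope_sumr//.
  by rewrite (partition_last ps) (partition_first ps).
have M2 : square_integrable P M.
  by apply: square_integrable_sum => k; exact: (D2 (ltn_ord k)).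
have M_ge : m2 * ((\sum_(k < n) h k `^ (2 * H)) / 2) <= \int[P]_w (M w ^+ 2).
  rewrite Rintegral_sqr_sum_orthogonal; last 2 first.
  - by move=> k; exact: (D2 (ltn_ord k)).
  - by move=> j k jk; apply: (D_orthogonal (ltn_ord k)); [exact: (D_adapted jk (ltn_ord k))|exact: (D2 (ltn_ord j))].
  by rewrite mulr_suml mulr_sumr; apply: ler_sum => k _; exact: (D_sqr_ge (ltn_ord k)).
have [_ BTE] := Rintegral_increment_sqr H0 H1 T0 fBm m2E (lexx 0) (ltW T0) (lexx T).
rewrite subr0 in BTE.
have M_le : \int[P]_w (M w ^+ 2) <=
    2 * \int[P]_w ((B T w - B 0 w) ^+ 2) + 2 * \int[P]_w (A w ^+ 2).
  apply: Rintegral_le2; [by case: M2|by case: BT2|by case: A2|move=> w].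
  by rewrite MA; have := sqr_ge0 (B T w - B 0 w + A w); lra.
rewrite -[leRHS]fineK; last by case: A2 => _ /(integrable_fin_num measurableT).
rewrite lee_fin -[leRHS]/(\int[P]_w (A w ^+ 2)).
rewrite BTE in M_le; rewrite mulrBr; lra.
Qed.

End compensator.

(** * Divergence along normally condensing partitions *)

Theorem theorem2p4 (R : realType) (d : measure_display) (Omega : measurableType d)
  (P : probability Omega R) (H T : R) (B : R -> Omega -> R)
  (theta : nat -> seq R) (Y : nat -> nat -> Omega -> R) :
  0 < H -> H < 1 / 2 -> 0 < T ->
  is_fBm P H T B ->
  normally_condensing T theta ->
  (forall n k, (k < (size (theta n)).-1)%N ->
     is_cond_exp P (natural_filtration B (theta n)`_k)
       (fun w => B (theta n)`_k.+1 w - B (theta n)`_k w) (Y n k)) ->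
  ereal_sup (range (fun n : nat =>
     (\int[P]_w ((\sum_(k < (size (theta n)).-1) Y n k w) ^+ 2)%:E)%E)) = +oo%E.
Proof.
move=> H0 H1 T0 fBm [part _ mesh0] YP.
have [m2 m2_gt0 m2E] := @normal_second_moment R.
have a01 : 0 < 2 * H < 1 by rewrite mulr_gt0//= mulrC -ltr_pdivlMr.
have b0 : 0 < 1 - 2 * H by case/andP: a01 => _; rewrite subr_gt0.
apply/eqyP => M M0.
(* [C] is the value of the sum of powers at which the bound of [compensator_sqr_ge] equals [M], and
   [e] below is the mesh at which [T] times the power [2 * H - 1] of [e] equals [C]; one partition
   finer than [e] then suffices. *)
pose C := 4 * (M / m2 + T `^ (2 * H)).
have C0 : 0 < C by rewrite mulr_gt0// ltr_wpDr ?powR_ge0// divr_gt0.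
pose e := (T / C) `^ (1 - 2 * H)^-1.
have TC : 0 < T / C by rewrite divr_gt0.
have e0 : 0 < e by exact: powR_gt0.
have /cvgrPdist_lt/(_ _ e0)[N _ /(_ N (leqnn _))] := mesh0.
rewrite /= sub0r normrN => /(le_lt_trans (ler_norm _)) meshN.
apply: (le_trans _ (ereal_sup_ubound (ex_intro2 _ _ N I erefl))).
apply: le_trans (compensator_sqr_ge H0 H1 T0 fBm (part N) (YP N) m2E m2_gt0).
rewrite lee_fin -ler_pdivrMl// mulrC lerBrDr ler_pdivlMr//.
apply: le_trans (sum_powR_ge T0 a01 (part N) e0 (ltW meshN)).
have -> : e `^ (2 * H - 1) = (T / C)^-1.
  by rewrite -opprB powRN /e -powRrM mulVf ?gt_eqF// powRr1// ltW.
by rewrite invf_div mulrCA divff ?gt_eqF// mulr1 /C [leLHS]mulrC.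
Qed.
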